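(* Let $\mathcal{M}=\{\mathcal{M}_k\}_{k\in\mathcal{D}}$ be an open quantum random walk on a distance set $\mathcal{D}$, given by the family $\{B_{i,j;k}\}_{i,j,k\in\mathcal{D}}$ of bounded operators on $\mathcal{H}$. Let $\{Q_{i,j}^k\}_{i,j,k\in\mathcal{D}}$ be non-negative numbers such that, for each $i,j\in\mathcal{D}$, $Q_{i,j}^k=0$ for all but finitely many $k\in\mathcal{D}$ and $\sum_{k\in\mathcal{D}}Q_{i,j}^k=1$. Then the following are equivalent: (a) for all $i,j,k,l\in\mathcal{D}$, $$\sum_{m\in\mathcal{D}}B_{m,j;l}^*B_{i,m;k}^*B_{i,m;k}B_{m,j;l}=\sum_{m\in\mathcal{D}}Q_{k,l}^m\,B_{i,j;m}^*B_{i,j;m};$$ (b) for all $k_1,k_2\in\mathcal{D}$ and every state $\rho\in\mathcal{B}_1(\mathcal{H}\otimes\mathcal{K})_{+,1}$, $$p^{(2;(k_1,k_2))}=d\left(\sum_{m\in\mathcal{D}}Q_{k_2,k_1}^m\mathcal{M}_m(\rho)\right),$$ where $p^{(2;(k_1,k_2))}=d(\mathcal{M}_{k_2}\circ\mathcal{M}_{k_1}(\rho))$. Moreover, if these conditions hold, then for every $n\ge 2$, every tuple $\mathbf{k}=(k_1,\dots,k_n)\in\mathcal{D}^n$ and every state $\rho\in\mathcal{B}_1(\mathcal{H}\otimes\mathcal{K})_{+,1}$, $$p^{(n;\mathbf{k})}=d\left(\sum_{m\in\mathcal{D}}Q_{k_n,\dots,k_1}^m\mathcal{M}_m(\rho)\right),$$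 where $p^{(n;\mathbf{k})}=d(\mathcal{M}_{k_n}\circ\cdots\circ\mathcal{M}_{k_1}(\rho))$.
   Context: Notation: $\mathbb{N}=\{1,2,\dots\}$, $\mathbb{N}_0=\mathbb{N}\cup\{0\}$. For a Hilbert space $\mathcal{L}$, $\mathcal{B}_1(\mathcal{L})$ is the space of trace class operators and $\mathcal{B}_1(\mathcal{L})_{+,1}=\{X\in\mathcal{B}_1(\mathcal{L}) : X\ge 0,\ \mathrm{Tr}(X)=1\}$ is the set of states. $|\xi\rangle\langle\eta|$ is the rank one operator $\zeta\mapsto\langle\eta,\zeta\rangle\xi$. Open quantum random walks on distance sets. A distance set $\mathcal{D}$ is either $\{0,\dots,N\}$ for some $N\in\mathbb{N}$ or $\mathbb{N}_0$. Let $\mathcal{K}$ be a Hilbert space with an orthonormal basis $\{|n\rangle\}_{n\in\mathcal{D}}$ and $\mathcal{H}$ a separable Hilbert space. Let $\{B_{i,j;k}\}_{i,j,k\in\mathcal{D}}$ be bounded operators on $\mathcal{H}$ with $\sum_{i\in\mathcal{D}}B_{i,j;k}^*B_{i,j;k}=\mathbf{1}$ (strong operator topology) for all $j,k\in\mathcal{D}$. Put $M_{i,j;k}=B_{i,j;k}\otimes|i\rangle\langle j|$ on $\mathcal{H}\otimes\mathcal{K}$. For $k\in\mathcal{D}$ the map $\mathcal{M}_k(X)=\sum_{i,j\in\mathcal{D}}M_{i,j;k}XM_{i,j;k}^*$ (convergence in trace norm for positive $X\in\mathcal{B}_1(\mathcal{H}\otimes\mathcal{K})$) extends linearly to $\mathcal{B}_1(\mathcal{H}\otimes\mathcal{K})$.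 The family $\mathcal{M}=\{\mathcal{M}_k\}_{k\in\mathcal{D}}$ is called an open quantum random walk (OQRW) on $\mathcal{D}$. For a state $\rho\in\mathcal{B}_1(\mathcal{H}\otimes\mathcal{K})_{+,1}$ let $\rho_j=U_j^*\rho U_j$, where $U_j:\mathcal{H}\to\mathcal{H}\otimes\mathcal{K}$, $U_j\xi=\xi\otimes|j\rangle$. Then $\mathcal{M}_k(\rho)=\sum_{i\in\mathcal{D}}\bigl(\sum_{j\in\mathcal{D}}B_{i,j;k}\rho_jB_{i,j;k}^*\bigr)\otimes|i\rangle\langle i|$ (trace norm convergence), and $\mathcal{M}_k(\rho)$ is again a state. Distribution. For a state of the form $\sigma=\sum_{i\in\mathcal{D}}\sigma_i\otimes|i\rangle\langle i|$ with positive $\sigma_i\in\mathcal{B}_1(\mathcal{H})$, its distribution is $d(\sigma)=(\mathrm{Tr}(\sigma_i))_{i\in\mathcal{D}}$. The series on the left-hand side in (a) converges in the ($\sigma$-)strong operator topology to a positive bounded operator. Numbers $Q_{k_1,\dots,k_n}^m$. On the free vector space over $\mathbb{C}$ with basis of symbols $\{Z_i\}_{i\in\mathcal{D}}$ define the (not necessarily associative, commutative or unital) bilinear product $Z_i\circ Z_j=\sum_{k\in\mathcal{D}}Q_{i,j}^kZ_k$. For $n\ge2$ and $k_1,\dots,k_n\in\mathcal{D}$, the numbers $Q_{k_1,\dots,k_n}^m$ are defined by taking products successively from the left: $((\cdots((Z_{k_1}\circ Z_{k_2})\circ Z_{k_3})\circ\cdots)\circ Z_{k_{n-1}})\circ Z_{k_n}=\sum_{m\in\mathcal{D}}Q_{k_1,\dots,k_n}^mZ_m$.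 *)

(* Defs.v *)
From HB Require Import structures.
From mathcomp Require Import all_boot all_order all_algebra.
From mathcomp Require Import sesquilinear complex.
From mathcomp Require Import all_classical all_reals all_analysis.
From mathcomp Require Import summability.

Set Implicit Arguments.
Unset Strict Implicit.
Unset Printing Implicit Defensive.

Import Order.TTheory GRing.Theory Num.Theory.
Import numFieldNormedType.Exports.

Local Open Scope classical_set_scope.
Local Open Scope complex_scope.
Local Open Scope ring_scope.

(* A complex Hilbert space: a Banach space whose norm comes from a positive
   definite Hermitian form. *)
HB.mixin Record isHilbert (R : realType) H of CompleteNormedModule R[i] H := {
  hdot : {dot H for @Num.conj R[i]} ;
  hdot_norm : forall x : H, hdot x x = `|x| ^+ 2
}.

#[short(type="hilbertType")]
HB.structure Definition Hilbert (R : realType) :=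
  {H of CompleteNormedModule R[i] H & isHilbert R H}.

(* The library's forms are linear in the first argument; [inner] is
   conjugate-linear in the first argument and linear in the second one. *)
Definition inner (R : realType) (H : hilbertType R) (x y : H) : R[i] :=
  (hdot : {dot H for @Num.conj R[i]}) y x.

Definition separable_space (T : topologicalType) :=
  exists2 A : set T, countable A & dense A.

Definition orthonormal_basis (R : realType) (H : hilbertType R) (I : eqType)
    (e : I -> H) : Prop :=
  (forall i j, inner (e i) (e j) = (i == j)%:R) /\
  dense [set x | exists s : seq (R[i] * I), x = \sum_(p <- s) p.1 *: e p.2].

(* Operators are bare functions: [H -> H'] carries the pointwise vector space
   structure, used below for sums and scalar multiples of operators. *)
Definition bounded_op (R : realType) (H H' : hilbertType R) (f : H -> H') :
    Prop :=
  linear f /\ exists M : R[i], forall x, `|f x| <= M * `|x|.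

Section Operators.
Variables (R : realType) (H H' : hilbertType R).

(* For bounded [f] the Riesz representation theorem gives exactly one [g]. *)
Definition adj (f : H -> H') : H' -> H :=
  xget (fun=> 0)
    [set g | bounded_op g /\ forall x y, inner (g y) x = inner y (f x)].

(* Convergence of a series of operators in the strong operator topology.
   Series are summed along the net of finite subsets of the index type. *)
Definition sot_sum (I : choiceType) (F : I -> H -> H') (S : H -> H') : Prop :=
  forall x, partial_sum (fun i => F i x) A @[A --> totally] --> S x.

End Operators.

Section TraceClass.
Variables (R : realType) (H : hilbertType R).

(* The order of [R[i]] makes [0 <= z] say that [z] is a nonnegative real. *)
Definition positive_op (X : H -> H) : Prop :=
  bounded_op X /\ forall x, 0 <= inner x (X x).

Definition hbasis : set H :=
  xget set0 [set E : set H | orthonormal_basis (fun v : E => \val v)].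

(* The trace of a positive operator: a sum of nonnegative terms, possibly
   infinite, over an orthonormal basis (the value does not depend on which). *)
Definition trace (X : H -> H) : \bar R :=
  \esum_(e in hbasis) (complex.Re (inner e (X e)))%:E.

(* [|X|], the positive square root of [X^* X] *)
Definition abs_op (X : H -> H) : H -> H :=
  xget (fun=> 0) [set P | positive_op P /\ P \o P = adj X \o X].

Definition trace_norm (X : H -> H) : \bar R := trace (abs_op X).

Definition trace_class (X : H -> H) : Prop :=
  bounded_op X /\ (trace_norm X < +oo)%E.

Definition state (X : H -> H) : Prop :=
  [/\ trace_class X, positive_op X & trace X = 1%E].

Definition trace_norm_sum (I : choiceType) (F : I -> H -> H) (S : H -> H) :=
  trace_class S /\
  trace_norm (S - partial_sum F A) @[A --> totally] --> 0%E.

Definition rank_one (x y : H) : H -> H := fun z => inner y z *: x.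

End TraceClass.

Section Tensor.
Variables (R : realType) (H K T : hilbertType R).
Variable tens : {bilinear H -> K -> T}.

(* [T], with [tens x y] as [x (x) y], is the Hilbert space tensor product of
   [H] and [K]. *)
Definition hilbert_tensor : Prop :=
  (forall x x' y y', inner (tens x y) (tens x' y') = inner x x' * inner y y') /\
  dense [set z | exists s : seq (H * K), z = \sum_(p <- s) tens p.1 p.2].

Definition op_tensor (A : H -> H) (C : K -> K) : T -> T :=
  xget (fun=> 0)
    [set S | bounded_op S /\ forall x y, S (tens x y) = tens (A x) (C y)].

End Tensor.

Definition distance_set (D : set nat) : Prop :=
  (exists2 N, (0 < N)%N & D = [set n | (n <= N)%N]) \/ D = setT.

Section OpenQuantumRandomWalk.
Variables (R : realType) (H K T : hilbertType R).
Variable tens : {bilinear H -> K -> T}.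
Variables (D : set nat) (ket : D -> K).

Definition oqrw_family (B : D -> D -> D -> H -> H) : Prop :=
  (forall i j k, bounded_op (B i j k)) /\
  (forall j k, sot_sum (fun i => adj (B i j k) \o B i j k) id).

Definition oqrw_kraus (B : D -> D -> D -> H -> H) (i j k : D) : T -> T :=
  op_tensor tens (B i j k) (rank_one (ket i) (ket j)).

(* For positive trace class [X] this is the defining series of the walk.  On a
   linear combination of such operators the series converges in trace norm to
   the corresponding combination of the sums, so that the same formula is the
   linear extension to all trace class operators. *)
Definition oqrw (B : D -> D -> D -> H -> H) (k : D) (X : T -> T) : T -> T :=
  xget (fun=> 0)
    [set Y | trace_norm_sum
      (fun p : D * D =>
         oqrw_kraus B p.1 p.2 k \o X \o adj (oqrw_kraus B p.1 p.2 k)) Y].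

Definition block_decomposition (sigma : T -> T) (s : D -> H -> H) : Prop :=
  (forall i, positive_op (s i) /\ trace_class (s i)) /\
  trace_norm_sum
    (fun i => op_tensor tens (s i) (rank_one (ket i) (ket i))) sigma.

(* The decomposition is unique when it exists. *)
Definition walk_distribution (sigma : T -> T) : D -> \bar R :=
  fun i => trace (xget (fun=> fun=> 0)
                    [set s | block_decomposition sigma s] i).

(* The successive application of the maps of index [k_1], then [k_2], etc. for
   [ks = [:: k_1; k_2; ...]]. *)
Definition oqrw_iter (B : D -> D -> D -> H -> H) (ks : seq D) (X : T -> T) :
  T -> T := foldl (fun Y k => oqrw B k Y) X ks.

End OpenQuantumRandomWalk.

Section StructureConstants.
Variables (R : realType) (D : set nat) (Q : D -> D -> D -> R).

(* Vectors of the free vector space on the symbols [Z_i] are given by their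
   finitely supported coordinate functions [D -> R[i]]. *)
Definition Zbasis (i : D) : D -> R[i] := fun m => (i == m)%:R.

Definition Zmul (f g : D -> R[i]) : D -> R[i] :=
  fun m => \sum_(i \in [set: D]) \sum_(j \in [set: D])
             f i * g j * (Q i j m)%:C.

Definition Qcoef (ks : seq D) (m : D) : R[i] :=
  if ks is k :: ks' then foldl Zmul (Zbasis k) (map Zbasis ks') m else 0.

End StructureConstants.

(* Main.v *)
Require Import Defs.
From HB Require Import structures.
From mathcomp Require Import all_boot all_order all_algebra.
From mathcomp Require Import sesquilinear complex.
From mathcomp Require Import all_classical all_reals all_analysis.
From mathcomp Require Import summability finmap ring lra.

Import Order.TTheory GRing.Theory Num.Theory.
Import numFieldNormedType.Exports.

Local Open Scope classical_set_scope.
Local Open Scope complex_scope.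
Local Open Scope ring_scope.

Set Implicit Arguments.
Unset Strict Implicit.
Unset Printing Implicit Defensive.

#[local] Existing Instance totally_filter.

(** A positive operator with square root P has the Gram expansion
    <x, X x> = sum_n |<v_n, x>|^2 with v_n = P e_n, and Parseval turns
    Tr (C X C^* ) into sum_n |C v_n|^2.  Writing w_{j,n} for the j-th block of v_n,
    the probability of site i after the steps l, k is therefore
    sum_{j,n,m} |B_{i,m;k} B_{m,j;l} w_{j,n}|^2, whereas the averaged one-step
    distribution is sum_{j,n,m} Q_{k,l}^m |B_{i,j;m} w_{j,n}|^2.  So (b) amounts to
    sum_m |B_{i,m;k} B_{m,j;l} x|^2 = sum_m Q_{k,l}^m |B_{i,j;m} x|^2 for all x
    (use the states |x (x) j><x (x) j| for the converse), and this is (a) tested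
    on vectors: a series of positive operators with bounded quadratic forms
    converges strongly, and its sum is determined by its quadratic form. *)

(** Adjoints, absolute values, tensor products of operators, the maps of the walk and the
    distributions are all values of [xget] with a default. Nothing can be computed from them before
    existence, and usually uniqueness, of the chosen object is established; most of the development
    serves this, down to the Riesz theorem and the square root. Two devices keep it uniform:
    positive operators are compared through real quadratic forms, and every trace becomes a sum of
    nonnegative extended reals, where the order of summation is free. In the n-step law the
    induction has to remove the step applied before all others. Condition (b) equates distributions,
    not states, and the distribution of M_k(Y) is in general not determined by that of Y, so the
    last step cannot be split off. Removing the earliest one lets the induction hypothesis act on
    M_{k_1}(X), and it corresponds to a factor Z_{k_1} on the right, which is how the left-nested
    product is built. *)

(** * The real scalar product underlying the Hermitian one *)

Section RealForm.
Context {R : realType} {H : hilbertType R}.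
Implicit Types x y z : H.

(** A real scalar product with the same squared norms. It keeps every estimate in the ordered field
    [R]; the imaginary part is recovered by rotating one argument by i. *)
Definition rip x y : R := complex.Re (inner x y).
Definition nrm2 x : R := rip x x.

Lemma innerC x y : inner x y = (inner y x)^*%C.
Proof. by rewrite /inner (hermC (hdot : {dot H for @Num.conj R[i]})) /= expr0 mul1r. Qed.

Lemma innerDr x y z : inner x (y + z) = inner x y + inner x z.
Proof. by rewrite /inner linearDl. Qed.

Lemma innerZr (a : R[i]) x y : inner x (a *: y) = a * inner x y.
Proof. by rewrite /inner linearZl_LR. Qed.

Lemma innerDl x y z : inner (y + z) x = inner y x + inner z x.
Proof. by rewrite ![inner _ x]innerC innerDr rmorphD. Qed.

Lemma innerZl (a : R[i]) x y : inner (a *: y) x = a^*%C * inner y x.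
Proof. by rewrite ![inner _ x]innerC innerZr rmorphM. Qed.

Lemma inner0r x : inner x 0 = 0.
Proof. by rewrite -(scale0r (0 : H)) innerZr mul0r. Qed.

Lemma rip_inner x y : inner x y = rip x y +i* rip ('i%C *: x) y.
Proof.
rewrite /rip innerZl; case: (inner x y) => a b /=.
by congr Complex; rewrite mul0r sub0r mulN1r opprK.
Qed.

Lemma ripC x y : rip x y = rip y x.
Proof. by rewrite /rip innerC; case: (inner y x). Qed.

Lemma ripDr x y z : rip x (y + z) = rip x y + rip x z.
Proof. by rewrite /rip innerDr raddfD. Qed.

Lemma ripDl x y z : rip (y + z) x = rip y x + rip z x.
Proof. by rewrite ripC ripDr !(ripC x). Qed.

Lemma ripZr (a : R) x y : rip x (a%:C *: y) = a * rip x y.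
Proof. by rewrite /rip innerZr; case: (inner x y) => b c /=; rewrite mul0r subr0. Qed.

Lemma ripZl (a : R) x y : rip (a%:C *: y) x = a * rip y x.
Proof. by rewrite ripC ripZr ripC. Qed.

Lemma rip_eq x x' : (forall y, rip x y = rip x' y) ->
  forall y, inner x y = inner x' y.
Proof.
move=> e y; rewrite innerC (innerC x'); congr conjc.
by rewrite !rip_inner ![rip _ x]ripC ![rip _ x']ripC !e.
Qed.

Lemma ripNr x y : rip x (- y) = - rip x y.
Proof. by rewrite -scaleN1r -(rmorphN1 (real_complex R)) ripZr mulN1r. Qed.

Lemma ripNl x y : rip (- x) y = - rip x y.
Proof. by rewrite ripC ripNr ripC. Qed.

Lemma ripBr x y z : rip x (y - z) = rip x y - rip x z.
Proof. by rewrite ripDr ripNr. Qed.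

Lemma ripBl x y z : rip (y - z) x = rip y x - rip z x.
Proof. by rewrite ripDl ripNl. Qed.

Lemma rip0r x : rip x 0 = 0. Proof. by rewrite /rip inner0r. Qed.
Lemma rip0l x : rip 0 x = 0. Proof. by rewrite ripC rip0r. Qed.

Lemma inner_nrm2 x : inner x x = (nrm2 x)%:C.
Proof.
rewrite /nrm2 /rip; move: (innerC x x); case: (inner x x) => a b /= [] e.
congr Complex; lra.
Qed.

Lemma norm_nrm2 x : `|x| ^+ 2 = (nrm2 x)%:C.
Proof. by rewrite -inner_nrm2 /inner hdot_norm. Qed.

Lemma nrm2_ge0 x : 0 <= nrm2 x.
Proof. by rewrite -lecR -norm_nrm2 exprn_ge0. Qed.

Lemma nrm2_eq0 x : (nrm2 x == 0) = (x == 0).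
Proof.
rewrite -(inj_eq (@complexI R)) -norm_nrm2 expf_eq0 /=; exact: normr_eq0.
Qed.

Lemma normE x : `|x| = (Num.sqrt (nrm2 x))%:C.
Proof.
apply/eqP; rewrite -(eqrXn2 (n := 2)) ?norm_nrm2 //; last first.
  by rewrite lecR sqrtr_ge0.
by rewrite -rmorphXn /= sqr_sqrtr ?nrm2_ge0.
Qed.

Lemma nrm2D x y : nrm2 (x + y) = nrm2 x + nrm2 y + 2 * rip x y.
Proof. by rewrite /nrm2 ripDl !ripDr (ripC y x); ring. Qed.

Lemma nrm2B x y : nrm2 (x - y) = nrm2 x + nrm2 y - 2 * rip x y.
Proof. by rewrite /nrm2 ripBl !ripBr (ripC y x); ring. Qed.

Lemma nrm2N x : nrm2 (- x) = nrm2 x.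
Proof. by rewrite /nrm2 ripNl ripNr opprK. Qed.

Lemma nrm2_distC x y : nrm2 (x - y) = nrm2 (y - x).
Proof. by rewrite -nrm2N opprB. Qed.

Lemma nrm2_0 : nrm2 0 = 0. Proof. exact: rip0r. Qed.

Lemma nrm2ZC (a : R[i]) x : (nrm2 (a *: x))%:C = `|a| ^+ 2 * (nrm2 x)%:C.
Proof. by rewrite -!norm_nrm2 normrZ exprMn. Qed.

Lemma nrm2Z (a : R) x : nrm2 (a%:C *: x) = a ^+ 2 * nrm2 x.
Proof. by rewrite /nrm2 ripZr ripZl mulrA. Qed.

(* [|<x,y>|^2] *)
Definition ip2 x y : R := rip x y ^+ 2 + rip ('i%C *: x) y ^+ 2.

Lemma ip2E x y : (ip2 x y)%:C = `|inner x y| ^+ 2.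
Proof. by rewrite -add_Re2_Im2 rip_inner. Qed.

Lemma ip2C x y : ip2 x y = ip2 y x.
Proof. by apply: complexI; rewrite !ip2E innerC normcJ. Qed.

Lemma ip2_ge0 x y : 0 <= ip2 x y.
Proof. by rewrite addr_ge0 ?sqr_ge0. Qed.

Lemma nrm2D_le x y : nrm2 (x + y) <= 2 * nrm2 x + 2 * nrm2 y.
Proof. by have := nrm2_ge0 (x - y); rewrite nrm2B nrm2D; lra. Qed.

End RealForm.

(** * Discriminants and the Cauchy-Schwarz inequality *)

Lemma discr_le (R : realType) (a b c : R) : 0 <= a ->
  (forall t, 0 <= a * t ^+ 2 + 2 * b * t + c) -> b ^+ 2 <= a * c.
Proof.
move=> a0 h; have [a00|an0] := eqVneq a 0.
  rewrite {}a00 in h *; have [->|bn0] := eqVneq b 0; first by rewrite expr0n mul0r.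
  (* The point where the affine function takes the value -1. *)
  have := h (- (c + 1) / (2 * b)).
  have -> : 2 * b * (- (c + 1) / (2 * b)) = - (c + 1) by field.
  by rewrite mul0r; lra.
have := h (- b / a).
have -> : a * (- b / a) ^+ 2 + 2 * b * (- b / a) + c = (a * c - b ^+ 2) / a.
  by field.
by rewrite pmulr_lge0 ?invr_gt0 ?lt_neqAle ?a0 1?eq_sym ?an0 // subr_ge0.
Qed.

Section CauchySchwarz.
Context {R : realType} {H : hilbertType R}.
Implicit Types x y : H.

Lemma rip_CS x y : rip x y ^+ 2 <= nrm2 x * nrm2 y.
Proof.
apply: discr_le; first exact: nrm2_ge0.
move=> t; have := nrm2_ge0 (t%:C *: x + y).
by rewrite nrm2D nrm2Z ripZl; lra.
Qed.

(** The real inequality is applied to the vector <x,y> x, whose real product with y is |<x,y>|^2;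
    one factor [ip2 x y] cancels. *)
Lemma ip2_CS x y : ip2 x y <= nrm2 x * nrm2 y.
Proof.
have [->|n0] := eqVneq (ip2 x y) 0; first by rewrite mulr_ge0 ?nrm2_ge0.
have := rip_CS (inner x y *: x) y.
have -> : rip (inner x y *: x) y = ip2 x y.
  apply: complexI; rewrite ip2E sqr_normc /rip innerZl mulrC.
  by case: (inner x y) => a b /=; congr Complex; ring.
have -> : nrm2 (inner x y *: x) = ip2 x y * nrm2 x.
  by apply: complexI; rewrite nrm2ZC -ip2E rmorphM.
rewrite expr2 -mulrA ler_pM2l // lt_neqAle eq_sym n0; exact: ip2_ge0.
Qed.

End CauchySchwarz.

Lemma norm_lt_sqr (R : realType) (z e : R) :
  0 < e -> z ^+ 2 < e ^+ 2 -> `|z| < e.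
Proof.
move=> e0; rewrite -[z ^+ 2]real_normK ?num_real // ltr_pXn2r ?nnegrE //.
exact: ltW.
Qed.

(** * Linear and bounded operators *)

Section Linear.
Context {R : realType} {H H' : hilbertType R} (f : H -> H') (lf : linear f).

Lemma lin_add x y : f (x + y) = f x + f y.
Proof. by rewrite -[x in LHS]scale1r lf scale1r. Qed.

Lemma lin_0 : f 0 = 0.
Proof. by have := lf (-1) 0 0; rewrite scaler0 addr0 scaleN1r addNr. Qed.

Lemma lin_scale a x : f (a *: x) = a *: f x.
Proof. by rewrite -[a *: x]addr0 lf lin_0 addr0. Qed.

Lemma lin_opp x : f (- x) = - f x.
Proof. by rewrite -scaleN1r lin_scale scaleN1r. Qed.

Lemma lin_sub x y : f (x - y) = f x - f y.
Proof. by rewrite lin_add lin_opp. Qed.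

Lemma lin_sum (I : Type) (s : seq I) (P : pred I) (F : I -> H) :
  f (\sum_(i <- s | P i) F i) = \sum_(i <- s | P i) f (F i).
Proof. exact: (big_morph f lin_add lin_0). Qed.

End Linear.

Section BoundedOp.
Context {R : realType}.
Implicit Types H : hilbertType R.

(** The constant of the definition lives in [R[i]]; squared norms allow a real nonnegative one. *)
Lemma bounded_opP H H' (f : H -> H') : bounded_op f <->
  linear f /\ exists2 c : R, 0 <= c & forall x, nrm2 (f x) <= c * nrm2 x.
Proof.
split=> [[lf [M fM]]|[lf [c c0 fc]]]; split=> //.
  (* On the zero space [M] is arbitrary, possibly not real, hence the absolute value of a real
     part. *)
  exists `|complex.Re (M ^+ 2)| => // x.
  have : (nrm2 (f x))%:C <= M ^+ 2 * (nrm2 x)%:C.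
    by rewrite -!norm_nrm2 -exprMn lerXn2r ?nnegrE ?(le_trans _ (fM x)).
  rewrite lecE => /andP[_] /le_trans; apply.
  have -> : complex.Re (M ^+ 2 * (nrm2 x)%:C) = complex.Re (M ^+ 2) * nrm2 x.
    by case: (M ^+ 2) => a b /=; rewrite mulr0 subr0.
  by rewrite ler_wpM2r ?nrm2_ge0 ?ler_norm.
exists (Num.sqrt c)%:C => x; rewrite !normE -rmorphM lecR -sqrtrM //.
by rewrite ler_sqrt ?mulr_ge0 ?nrm2_ge0.
Qed.

Lemma bounded_op_lin H H' (f : H -> H') : bounded_op f -> linear f.
Proof. by case. Qed.

Lemma bounded_op_comp H H' H'' (f : H' -> H'') (g : H -> H') :
  bounded_op f -> bounded_op g -> bounded_op (f \o g).
Proof.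
move=> /bounded_opP[lf [c c0 fc]] /bounded_opP[lg [d d0 gd]].
apply/bounded_opP; split; first by move=> a x y /=; rewrite lg lf.
exists (c * d) => [|x /=]; first exact: mulr_ge0.
by rewrite (le_trans (fc _)) // -mulrA ler_wpM2l.
Qed.

Lemma bounded_opD H H' (f g : H -> H') :
  bounded_op f -> bounded_op g -> bounded_op (f + g).
Proof.
move=> /bounded_opP[lf [c c0 fc]] /bounded_opP[lg [d d0 gd]].
apply/bounded_opP; split=> [a x y|].
  by rewrite /= !fctE lg lf scalerDr addrACA.
exists (2 * c + 2 * d) => [|x /=]; first by rewrite addr_ge0 ?mulr_ge0.
rewrite fctE (le_trans (nrm2D_le _ _)) //.
by move: (fc x) (gd x) => h h'; lra.
Qed.

Lemma bounded_opZ H H' (a : R[i]) (f : H -> H') :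
  bounded_op f -> bounded_op (a *: f).
Proof.
move=> /bounded_opP[lf [c c0 fc]].
apply/bounded_opP; split=> [b x y|].
  by rewrite /= !fctE lf scalerDr !scalerA mulrC.
have a0 : 0 <= complex.Re (`|a| ^+ 2).
  by rewrite -add_Re2_Im2 addr_ge0 ?sqr_ge0.
exists (complex.Re (`|a| ^+ 2) * c) => [|x /=]; first exact: mulr_ge0.
have -> : nrm2 ((a *: f) x) = complex.Re (`|a| ^+ 2) * nrm2 (f x).
  by apply: complexI; rewrite nrm2ZC -add_Re2_Im2 rmorphM.
by rewrite -mulrA ler_wpM2l.
Qed.

Lemma bounded_op0 H H' : bounded_op (0 : H -> H').
Proof.
apply/bounded_opP; split=> [a x y|]; first by rewrite /= scaler0 addr0.
by exists 0 => // x; rewrite mul0r (_ : nrm2 _ = 0) //; exact: nrm2_0.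
Qed.

Lemma bounded_op_id H : bounded_op (@id H).
Proof. by apply/bounded_opP; split=> //; exists 1 => // x; rewrite mul1r. Qed.

Lemma bounded_opB H H' (f g : H -> H') :
  bounded_op f -> bounded_op g -> bounded_op (f - g).
Proof.
by move=> bf bg; rewrite -scaleN1r; apply: bounded_opD => //; apply: bounded_opZ.
Qed.

Lemma bounded_op_sum H H' (I : Type) (s : seq I) (P : pred I)
    (F : I -> H -> H') : (forall i, P i -> bounded_op (F i)) ->
  bounded_op (\sum_(i <- s | P i) F i).
Proof.
by move=> bF; elim/big_ind : _ => //; [exact: bounded_op0|exact: bounded_opD].
Qed.

End BoundedOp.

(** * Convergence in Hilbert spaces *)

Section Convergence.
Context {R : realType} {H : hilbertType R}.

(** Positive elements of [R[i]] are real, so complex radii can be traded for real bounds on squared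
    norms. *)
Lemma cvg_nrm2P (T : Type) (F : set_system T) {FF : Filter F} (u : T -> H) (l : H) :
  u x @[x --> F] --> l <->
  forall e : R, 0 < e -> \forall x \near F, nrm2 (u x - l) < e.
Proof.
split=> [/cvgrPdist_lt ul e e0|ul].
  have /ul : 0 < (Num.sqrt e)%:C :> R[i] by rewrite ltcR sqrtr_gt0.
  apply: filterS => x; rewrite normE ltcR ltr_sqrt // nrm2_distC //.
apply/cvgrPdist_lt => e e0.
have eE : e = (complex.Re e)%:C.
  by case: e e0 => a b; rewrite ltcE /= => /andP[/eqP ->].
move: e0; rewrite eE ltcR => e0.
have := ul _ (exprn_gt0 2 e0); apply: filterS => x.
rewrite nrm2_distC normE ltcR => h.
by rewrite -(ltr_pXn2r (n := 2)) ?nnegrE ?sqrtr_ge0 ?ltW // sqr_sqrtr ?nrm2_ge0.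
Qed.

Lemma cvg_hilbert (T : Type) (F : set_system T) {FF : ProperFilter F}
    (u : T -> H) :
  (forall e : R, 0 < e -> exists l, \forall x \near F, nrm2 (u x - l) < e) ->
  exists l : H, u x @[x --> F] --> l.
Proof.
move=> cu; apply/cvg_ex/cauchy_cvgP/cauchy_exP => e e0.
have eE : e = (complex.Re e)%:C.
  by case: e e0 => a b; rewrite ltcE /= => /andP[/eqP ->].
move: e0; rewrite eE ltcR => e0.
have [l ul] := cu _ (exprn_gt0 2 e0); exists l; apply: filterS ul => x.
rewrite -ball_normE /= normE ltcR nrm2_distC => h.
by rewrite -(ltr_pXn2r (n := 2)) ?nnegrE ?sqrtr_ge0 ?ltW // sqr_sqrtr ?nrm2_ge0.
Qed.

Lemma cvg_hilbert_unique (T : Type) (F : set_system T) {FF : ProperFilter F}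
    (u : T -> H) (l l' : H) :
  u x @[x --> F] --> l -> u x @[x --> F] --> l' -> l = l'.
Proof. by move=> ul ul'; apply: (cvg_unique _ ul ul'); exact: norm_hausdorff. Qed.

End Convergence.

Section ConvergenceOp.
Context {R : realType} {H : hilbertType R}.

Lemma cvg_bounded_op (H' : hilbertType R) (T : Type) (F : set_system T)
    {FF : Filter F} (u : T -> H) (l : H) (f : H -> H') : bounded_op f ->
  u x @[x --> F] --> l -> f (u x) @[x --> F] --> f l.
Proof.
move=> /bounded_opP[lf [c c0 fc]] /cvg_nrm2P ul; apply/cvg_nrm2P => e e0.
have /ul : 0 < e / (c + 1) by rewrite divr_gt0 // ltr_wpDl.
apply: filterS => x h; rewrite -(lin_sub lf) (le_lt_trans (fc _)) //.
rewrite ltr_pdivlMr ?ltr_wpDl // in h; apply: le_lt_trans h.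
by rewrite mulrC ler_wpM2l ?nrm2_ge0 // lerDl.
Qed.

Lemma cvg_rip (T : Type) (F : set_system T) {FF : Filter F} (u : T -> H) (l y : H) :
  u x @[x --> F] --> l -> rip y (u x) @[x --> F] --> rip y l.
Proof.
move=> /cvg_nrm2P ul; apply/cvgrPdist_lt => e e0.
have /ul : 0 < e ^+ 2 / (nrm2 y + 1).
  by rewrite divr_gt0 ?exprn_gt0 // ltr_wpDl ?nrm2_ge0.
apply: filterS => x h.
rewrite ltr_pdivlMr ?ltr_wpDl ?nrm2_ge0 // in h.
apply: norm_lt_sqr => //; rewrite -ripBr (le_lt_trans (rip_CS _ _)) // nrm2_distC.
by rewrite (le_lt_trans _ h) // mulrC ler_wpM2l ?nrm2_ge0 ?lerDl.
Qed.

Lemma dense_nrm2 (A : set H) x (e : R) : dense A -> 0 < e ->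
  exists2 y, A y & nrm2 (x - y) < e.
Proof.
move=> dA e0; have d0 : 0 < (Num.sqrt e)%:C :> R[i] by rewrite ltcR sqrtr_gt0.
have [||y [/interior_subset xy Ay]] := dA (ball x (Num.sqrt e)%:C)^°.
- by exists x; apply: nbhsx_ballx.
- exact: open_interior.
by exists y => //; move: xy; rewrite -ball_normE /= normE ltcR ltr_sqrt.
Qed.

Lemma bounded_op_dense0 (H' : hilbertType R) (f : H -> H') (A : set H) :
  bounded_op f -> dense A -> (forall x, A x -> f x = 0) -> f = 0.
Proof.
move=> bf dA fA; apply/funext => x.
move/bounded_opP: (bf) => [lf [c c0 fc]].
apply/eqP; rewrite -nrm2_eq0 eq_le nrm2_ge0 andbT.
apply/ler_addgt0Pr => e e0; rewrite add0r.
have d0 : 0 < e / (c + 1) by rewrite divr_gt0 // ltr_wpDl.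
have [y Ay] := dense_nrm2 x dA d0; rewrite ltr_pdivlMr ?ltr_wpDl // => h.
have -> : f x = f (x - y) by rewrite (lin_sub lf) (fA y) // subr0.
apply: le_trans (fc _) _; apply: le_trans (ltW h).
by rewrite mulrC ler_wpM2l ?nrm2_ge0 // lerDl.
Qed.

Lemma bounded_op_dense (H' : hilbertType R) (f g : H -> H') (A : set H) :
  bounded_op f -> bounded_op g -> dense A -> (forall x, A x -> f x = g x) ->
  f = g.
Proof.
move=> bf bg dA fg; apply/eqP; rewrite -subr_eq0; apply/eqP.
apply: bounded_op_dense0 dA _; first exact: bounded_opB.
by move=> x /fg fgx; rewrite !fctE fgx subrr.
Qed.

End ConvergenceOp.

(** * Riesz representation and adjoints *)

Section Riesz.
Context {R : realType} {H : hilbertType R}.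

(* The representing vector is the limit of the minimising filter of
   [x |-> |x|^2 - 2 g x]. *)
Lemma riesz_real (g : H -> R) (c : R) :
  (forall x y, g (x + y) = g x + g y) ->
  (forall (a : R) x, g (a%:C *: x) = a * g x) ->
  (forall x, g x ^+ 2 <= c * nrm2 x) ->
  exists v, forall x, rip v x = g x.
Proof.
move=> gD gZ gc; pose J x := nrm2 x - 2 * g x.
have Jlb x : - `|c| <= J x.
  have := nrm2_ge0 x; have := gc x; rewrite /J => h n0.
  have [g0|g0] := lerP (g x) 0; first by have := normr_ge0 c; lra.
  have : (2 * g x) ^+ 2 <= (`|c| + nrm2 x) ^+ 2.
    have := sqr_ge0 (`|c| - nrm2 x).
    have : c * nrm2 x <= `|c| * nrm2 x by rewrite ler_wpM2r ?ler_norm.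
    by move: h; rewrite !expr2; lra.
  by rewrite ler_sqr ?nnegrE ?addr_ge0 ?mulr_ge0 ?(ltW g0) //; lra.
have Jinf : has_inf (range J).
  by split; [exists (J 0), 0|exists (- `|c|) => _ [x _ <-]; exact: Jlb].
pose m := inf (range J).
have Jm x : m <= J x by apply: ge_inf; [case: Jinf|exists x].
have Jadh (e : R) : 0 < e -> exists x, J x < m + e.
  by move=> e0; have [_ [x _ <-] h] := inf_adherent e0 Jinf; exists x.
pose F := filter_from [set e : R | 0 < e] (fun e => [set x | J x < m + e]).
have FF : ProperFilter F.
  apply: filter_from_proper => [|e /Jadh[x]]; last by exists x.
  apply: filter_from_filter; first by exists 1 => /=.
  move=> e d /= e0 d0; exists (Num.min e d) => /=; first by rewrite lt_min e0.
  move=> x /= h; split => /=; apply: (lt_le_trans h); rewrite lerD2l ge_min lexx //.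
  by rewrite orbT.
(* Parallelogram identity, with [m] as lower bound of [J] at the midpoint: sublevel sets just above
   [m] have small diameter, so [F] is Cauchy. *)
have Jpar x y : nrm2 (x - y) <= 2 * J x + 2 * J y - 4 * m.
  have := Jm ((2^-1)%:C *: (x + y)).
  by rewrite /J nrm2Z gZ gD nrm2D nrm2B expr2; lra.
have [l] : exists l : H, x @[x --> F] --> l.
  apply: cvg_hilbert => e e0; have e8 : 0 < e / 4 by rewrite divr_gt0.
  have [x0 Jx0] := Jadh _ e8; exists x0; exists (e / 4) => // x /= Jx.
  by rewrite (le_lt_trans (Jpar _ _)) //; move: Jx Jx0; lra.
move=> /cvg_nrm2P Fl; exists l => y.
apply/eqP; rewrite -subr_eq0 -sqrf_eq0 eq_le sqr_ge0 andbT.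
apply/ler_addgt0Pr => e e0; rewrite add0r.
(* The error at [y] splits into the terms of [h1] and [h2], each with square at most d |y|^2;
   squaring their sum costs a factor 2, hence the 4. *)
pose d := e / (4 * (nrm2 y + 1)).
have n0 : 0 <= nrm2 y := nrm2_ge0 y.
have d0 : 0 < d by rewrite divr_gt0 // mulr_gt0 // ltr_wpDl.
have /filter_ex[x [Jx xl]] : F ([set x | J x < m + d] `&` [set x | nrm2 (x - l) < d]).
  by apply: filterI; [exists d|exact: Fl].
(* Minimality up to [d] along the line x + t y makes |y|^2 t^2 + 2 (<x,y> - g y) t + d nonnegative
   for all t. *)
have h1 : (rip x y - g y) ^+ 2 <= nrm2 y * d.
  apply: discr_le => // t; have := Jm (x + t%:C *: y).
  by move: Jx; rewrite /J /= nrm2D nrm2Z gD gZ ripZr; lra.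
have h2 : rip (x - l) y ^+ 2 <= d * nrm2 y.
  by rewrite (le_trans (rip_CS _ _)) // ler_wpM2r // ltW.
have h3 : 4 * (nrm2 y * d) <= e.
  rewrite /d mulrA mulrCA mulrA ler_pdivrMr ?mulr_gt0 ?ltr_wpDl //.
  by rewrite mulrA mulrAC [X in _ <= X]mulrC; nra.
rewrite ripBl in h2.
have := sqr_ge0 ((rip x y - g y) + (rip x y - rip l y)).
by move: h1 h2 h3; rewrite !expr2; lra.
Qed.

Lemma rip_ii (x y : H) : rip ('i%C *: x) ('i%C *: y) = rip x y.
Proof.
rewrite /rip innerZl innerZr; case: (inner x y) => a b /=; ring.
Qed.

Lemma rip_ir (x y : H) : rip x ('i%C *: y) = - rip ('i%C *: x) y.
Proof.
rewrite /rip innerZl innerZr; case: (inner x y) => a b /=; ring.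
Qed.

Lemma inner_ext (x y : H) : (forall z, inner x z = inner y z) -> x = y.
Proof.
move=> h; apply/eqP; rewrite -subr_eq0 -nrm2_eq0 /nrm2 ripBl /rip h; apply/eqP.
by rewrite subrr.
Qed.

Lemma rip_ext (x y : H) : (forall z, rip x z = rip y z) -> x = y.
Proof. by move=> h; apply: inner_ext; exact: rip_eq. Qed.

End Riesz.

Section Adjoint.
Context {R : realType} {H H' : hilbertType R}.

(** The real Riesz theorem suffices: replacing x by ix turns equality of real parts into equality of
    imaginary parts. The bound on [g] is Cauchy-Schwarz at x = g y. *)
Lemma adj_exists (f : H -> H') : bounded_op f ->
  exists g, bounded_op g /\ forall x y, inner (g y) x = inner y (f x).
Proof.
move=> /bounded_opP[lf [c c0 fc]].
have fCS y x : rip y (f x) ^+ 2 <= nrm2 y * c * nrm2 x.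
  by rewrite (le_trans (rip_CS _ _)) // -mulrA ler_wpM2l ?nrm2_ge0.
have /choice[g gE] y : exists v, forall x, rip v x = rip y (f x).
  apply: riesz_real (fCS y) => [x z|a x]; first by rewrite (lin_add lf) ripDr.
  by rewrite (lin_scale lf) ripZr.
have gE' x y : inner (g y) x = inner y (f x).
  rewrite !rip_inner gE; congr Complex; apply: oppr_inj.
  by rewrite -!rip_ir gE (lin_scale lf).
exists g; split=> //; apply/bounded_opP; split=> [a y z|].
  by apply: inner_ext => x; rewrite innerDl innerZl !gE' innerDl innerZl.
exists c => // y; have [->|n0] := eqVneq (nrm2 (g y)) 0.
  by rewrite mulr_ge0 ?nrm2_ge0.
have := fCS y (g y); rewrite -gE expr2 ler_pM2r 1?mulrC //.
by rewrite lt_neqAle eq_sym n0 nrm2_ge0.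
Qed.

Lemma adjP (f : H -> H') : bounded_op f ->
  bounded_op (adj f) /\ forall x y, inner (adj f y) x = inner y (f x).
Proof. by move=> /adj_exists; exact: (@xgetPex _ (fun=> 0)). Qed.

Lemma bounded_adj (f : H -> H') : bounded_op f -> bounded_op (adj f).
Proof. by case/adjP. Qed.

Lemma inner_adj (f : H -> H') x y : bounded_op f ->
  inner (adj f y) x = inner y (f x).
Proof. by case/adjP. Qed.

Lemma rip_adj (f : H -> H') x y : bounded_op f ->
  rip (adj f y) x = rip y (f x).
Proof. by move=> bf; rewrite /rip inner_adj. Qed.

Lemma adj_unique (f : H -> H') g : bounded_op f ->
  (forall x y, rip (g y) x = rip y (f x)) -> adj f = g.
Proof.
by move=> bf gE; apply/funext => y; apply: rip_ext => x; rewrite rip_adj ?gE.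
Qed.

End Adjoint.

Section AdjointAlgebra.
Context {R : realType} {H H' H'' : hilbertType R}.

Lemma adjK (f : H -> H') : bounded_op f -> adj (adj f) = f.
Proof.
move=> bf; apply: adj_unique; first exact: bounded_adj.
by move=> x y; rewrite [RHS]ripC rip_adj // ripC.
Qed.

Lemma adj_comp (f : H' -> H'') (g : H -> H') : bounded_op f -> bounded_op g ->
  adj (f \o g) = adj g \o adj f.
Proof.
move=> bf bg; apply: adj_unique; first exact: bounded_op_comp.
by move=> x y /=; rewrite !rip_adj.
Qed.

End AdjointAlgebra.

(** * Positive operators and their quadratic forms *)

Section Positive.
Context {R : realType}.
Implicit Types H : hilbertType R.

(** For a positive operator <x, X x> is real, so the real part is the whole quadratic form. *)
Definition qf H (X : H -> H) (x : H) : R := rip x (X x).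

(** Polarisation: the imaginary part of <z, X z> vanishes at z = y - ix, which gives symmetry.
    Conversely, symmetry at the pair x, ix makes <x, X x> real. *)
Lemma positive_opP H (X : H -> H) : positive_op X <->
  [/\ bounded_op X, (forall x y, rip x (X y) = rip (X x) y)
    & forall x, 0 <= qf X x].
Proof.
split=> [[bX X0]|[bX Xs X0]].
  have lX := bounded_op_lin bX.
  have Xim x : rip ('i%C *: x) (X x) = 0.
    by have := X0 x; rewrite lecE rip_inner => /andP[/eqP].
  split=> // [x y|x]; last first.
    by have := X0 x; rewrite lecE rip_inner => /andP[].
  have := Xim (- 'i%C *: x + y).
  rewrite (lin_add lX) (lin_scale lX) scalerDr scalerA mulrN -expr2 sqr_i opprK.
  rewrite scale1r ripDl !ripDr !scaleNr !ripNr Xim rip_ir rip_ii Xim (ripC y) .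
  by lra.
split=> // x; rewrite rip_inner lecE X0 andbT /=.
have := Xs x ('i%C *: x); rewrite (lin_scale (bounded_op_lin bX)).
by rewrite (ripC (X x)) rip_ir => h; apply/eqP; lra.
Qed.

Section PositiveTheory.
Context {H : hilbertType R}.
Implicit Types X Y : H -> H.

Lemma positive_bounded X : positive_op X -> bounded_op X.
Proof. by case. Qed.

Lemma positive_lin X : positive_op X -> linear X.
Proof. by case=> -[]. Qed.

Lemma positive_sym X : positive_op X -> forall x y, rip x (X y) = rip (X x) y.
Proof. by case/positive_opP. Qed.

Lemma qf_ge0 X x : positive_op X -> 0 <= qf X x.
Proof. by case/positive_opP. Qed.

Lemma positive_adj X : positive_op X -> adj X = X.
Proof.
by move=> pX; apply: adj_unique (positive_bounded pX) _ => x y; rewrite positive_sym.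
Qed.

Lemma qf_comb X (t : R) x y : positive_op X ->
  qf X (t%:C *: x + y) = qf X x * t ^+ 2 + 2 * rip x (X y) * t + qf X y.
Proof.
move=> pX; rewrite /qf (positive_lin pX) ripDl !ripDr !ripZl !ripZr.
by rewrite (positive_sym pX y) (ripC (X y)); ring.
Qed.

Lemma positive_CS X x y : positive_op X ->
  rip x (X y) ^+ 2 <= qf X x * qf X y.
Proof.
move=> pX; apply: discr_le; first exact: qf_ge0.
by move=> t; rewrite -qf_comb // qf_ge0.
Qed.

(** Cauchy-Schwarz for the form of [X] at [X x] and [x] gives |X x|^4 <= c |X x|^2 <x, X x>. This is
    what converts convergence of quadratic forms into convergence in norm. *)
Lemma positive_nrm2 X (c : R) x : positive_op X -> 0 <= c ->
  (forall y, qf X y <= c * nrm2 y) -> nrm2 (X x) <= c * qf X x.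
Proof.
move=> pX c0 Xc; have [->|n0] := eqVneq (nrm2 (X x)) 0.
  by rewrite mulr_ge0 ?qf_ge0.
have := le_trans (positive_CS (X x) x pX) (ler_wpM2r (qf_ge0 x pX) (Xc _)).
by rewrite mulrAC expr2 ler_pM2r // lt_neqAle eq_sym n0 nrm2_ge0.
Qed.

Lemma positive_ext X Y : positive_op X -> positive_op Y ->
  (forall x, qf X x = qf Y x) -> X = Y.
Proof.
move=> pX pY XY; apply/funext => y; apply: rip_ext => x.
have := XY (1%:C *: x + y); rewrite !qf_comb // !XY.
by rewrite ![rip (_ y) x]ripC; lra.
Qed.

Lemma positive_op0 : positive_op (0 : H -> H).
Proof. by split=> [|x]; [exact: bounded_op0|rewrite inner0r]. Qed.

Lemma positive_opD X Y : positive_op X -> positive_op Y -> positive_op (X + Y).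
Proof.
move=> [bX X0] [bY Y0]; split=> [|x]; first exact: bounded_opD.
by rewrite fctE innerDr addr_ge0.
Qed.

Lemma positive_opZ (a : R) X : 0 <= a -> positive_op X ->
  positive_op (a%:C *: X).
Proof.
move=> a0 [bX X0]; split=> [|x]; first exact: bounded_opZ.
by rewrite fctE innerZr mulr_ge0 ?ler0c.
Qed.

Lemma qfD X Y x : qf (X + Y) x = qf X x + qf Y x.
Proof. by rewrite /qf ripDr. Qed.

Lemma qfB X Y x : qf (X - Y) x = qf X x - qf Y x.
Proof. by rewrite /qf ripBr. Qed.

Lemma qfZ (a : R) X x : qf (a%:C *: X) x = a * qf X x.
Proof. by rewrite /qf ripZr. Qed.

Lemma qf0 x : qf (0 : H -> H) x = 0.
Proof. exact: rip0r. Qed.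

Lemma qf_sum (I : Type) (s : seq I) (P : pred I) (F : I -> H -> H) x :
  qf (\sum_(i <- s | P i) F i) x = \sum_(i <- s | P i) qf (F i) x.
Proof.
by apply: (big_morph (fun X => qf X x)) => [X Y|]; rewrite ?qfD ?qf0.
Qed.

Lemma positive_opB X Y : positive_op X -> positive_op Y ->
  (forall x, qf Y x <= qf X x) -> positive_op (X - Y).
Proof.
move=> /positive_opP[bX Xs _] /positive_opP[bY Ys _] YX.
apply/positive_opP; split=> [|x y|x]; first exact: bounded_opB.
  by rewrite !fctE ripBr Xs Ys ripBl.
by rewrite qfB subr_ge0.
Qed.

Lemma positive_op_sum (I : Type) (s : seq I) (P : pred I) (F : I -> H -> H) :
  (forall i, P i -> positive_op (F i)) ->
  positive_op (\sum_(i <- s | P i) F i).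
Proof.
by move=> pF; elim/big_ind : _ => //; [exact: positive_op0|exact: positive_opD].
Qed.

Lemma positive_id : positive_op (@id H).
Proof.
by split=> [|x]; [exact: bounded_op_id|rewrite inner_nrm2 ler0c nrm2_ge0].
Qed.

End PositiveTheory.

Lemma positive_conj H H' (C : H -> H') (X : H -> H) :
  bounded_op C -> positive_op X -> positive_op (C \o X \o adj C).
Proof.
move=> bC [bX X0]; split=> [|x /=].
  exact: bounded_op_comp (bounded_op_comp bC bX) (bounded_adj bC).
by rewrite -inner_adj.
Qed.

Lemma qf_conj H H' (C : H -> H') (X : H -> H) x :
  bounded_op C -> qf (C \o X \o adj C) x = qf X (adj C x).
Proof. by move=> bC; rewrite /qf /= -rip_adj. Qed.

Lemma positive_sqr H H' (C : H -> H') :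
  bounded_op C -> positive_op (adj C \o C).
Proof.
move=> bC; split=> [|x /=]; first exact: bounded_op_comp (bounded_adj bC) bC.
by rewrite innerC inner_adj // -innerC inner_nrm2 ler0c nrm2_ge0.
Qed.

Lemma qf_sqr H H' (C : H -> H') x : bounded_op C ->
  qf (adj C \o C) x = nrm2 (C x).
Proof. by move=> bC; rewrite /qf /= ripC rip_adj. Qed.

End Positive.

(** * Unordered sums of nonnegative reals *)

Lemma cvg_real_unique (R : realType) (T : Type) (F : set_system T)
    {FF : ProperFilter F} (u : T -> R) (l l' : R) :
  u x @[x --> F] --> l -> u x @[x --> F] --> l' -> l = l'.
Proof. exact: (cvg_unique (@norm_hausdorff R R)). Qed.

Lemma cvg_ext (T : Type) (V : topologicalType) (F : set_system T)
    (g f : T -> V) (l : V) :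
  g =1 f -> f x @[x --> F] --> l -> g x @[x --> F] --> l.
Proof. by move=> /funext ->. Qed.

Section NonnegativeSums.
Context {R : realType} {I : choiceType}.
Implicit Types f : I -> R.

Lemma near_totally (A0 : {fset I}) (P : {fset I} -> Prop) :
  (forall A : {fset I}, (A0 `<=` A)%fset -> P A) -> \forall A \near totally, P A.
Proof. by move=> h; exists A0. Qed.

Lemma partial_sumE (V : zmodType) (F : I -> V) (A : {fset I}) :
  partial_sum F A = \sum_(i <- A) F i.
Proof. by rewrite /partial_sum big_seq_fsetE. Qed.

Lemma sum_fsetD (V : zmodType) (F : I -> V) (A0 A : {fset I}) :
  (A0 `<=` A)%fset ->
  \sum_(i <- A) F i = \sum_(i <- A0) F i + \sum_(i <- (A `\` A0)%fset) F i.
Proof.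
move=> sA; rewrite (big_fsetID _ (mem A0)) /=; congr (_ + _).
  congr (\sum_(i <- _) _); congr enum_fset; apply/fsetP => i.
  by rewrite !inE /= andbC; case: (boolP (i \in A0)) => //= /(fsubsetP sA).
congr (\sum_(i <- _) _); congr enum_fset; apply/fsetP => i.
by rewrite !inE /= andbC.
Qed.

Lemma sum_fset_le f (A0 A : {fset I}) : (forall i, 0 <= f i) ->
  (A0 `<=` A)%fset -> \sum_(i <- A0) f i <= \sum_(i <- A) f i.
Proof. by move=> f0 sA; rewrite (sum_fsetD _ sA) lerDl sumr_ge0. Qed.

Lemma esum_le f (s : R) :
  (forall A : {fset I}, \sum_(i <- A) f i <= s) ->
  (\esum_(i in [set: I]) (f i)%:E <= s%:E)%E.
Proof.
move=> fs; apply: ge_ereal_sup => _ [A [finA _]] <-.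
by rewrite fsbig_finite //= sumEFin lee_fin.
Qed.

Lemma le_fset_esum f (A : {fset I}) :
  ((\sum_(i <- A) f i)%:E <= \esum_(i in [set: I]) (f i)%:E)%E.
Proof.
apply: esum_ge; exists [set` A]; first by split.
by rewrite fsbig_finite //= set_fsetK sumEFin.
Qed.

(** The finite sums increase along [totally], so their supremum is their limit. *)
Lemma cvg_esum_fset f (s : R) : (forall i, 0 <= f i) ->
  \esum_(i in [set: I]) (f i)%:E = s%:E ->
  (\sum_(i <- A) f i) @[A --> totally] --> s.
Proof.
move=> f0 fs; apply/cvgrPdist_lt => e e0.
have le_s (A : {fset I}) : \sum_(i <- A) f i <= s.
  by rewrite -lee_fin -fs le_fset_esum.
have [A0 A0s] : exists A0 : {fset I}, s - e < \sum_(i <- A0) f i.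
  apply: contrapT => /forallNP h.
  suff : (s%:E <= (s - e)%:E)%E by rewrite lee_fin; lra.
  by rewrite -fs; apply: esum_le => A; rewrite leNgt; apply/negP/h.
apply: (near_totally (A0 := A0)) => A sA.
by rewrite ger0_norm ?subr_ge0 //; have := sum_fset_le f0 sA; lra.
Qed.

Lemma esum_cvg_fset f (s : R) : (forall i, 0 <= f i) ->
  (\sum_(i <- A) f i) @[A --> totally] --> s ->
  \esum_(i in [set: I]) (f i)%:E = s%:E.
Proof.
move=> f0 fs; have le_s : (\esum_(i in [set: I]) (f i)%:E <= s%:E)%E.
  apply: esum_le => A0; apply: (cvgr_to_ge fs).
  by apply: (near_totally (A0 := A0)) => A; exact: sum_fset_le.
have ge0 : (0 <= \esum_(i in [set: I]) (f i)%:E)%E.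
  by apply: esum_ge0 => i _; rewrite lee_fin.
have [t tE] : exists t, \esum_(i in [set: I]) (f i)%:E = t%:E.
  exists (fine (\esum_(i in [set: I]) (f i)%:E)).
  by rewrite fineK // ge0_fin_numE // (le_lt_trans le_s) ?ltry.
rewrite tE; congr EFin; exact: cvg_real_unique (cvg_esum_fset f0 tE) fs.
Qed.

End NonnegativeSums.

(** * Strong convergence of series of positive operators *)

Section MonotoneConvergence.
Context {R : realType} {H : hilbertType R}.

Lemma cvg_nrm2 (T : Type) (F : set_system T) {FF : Filter F} (u : T -> H)
    (l : H) : u x @[x --> F] --> l -> nrm2 (u x) @[x --> F] --> nrm2 l.
Proof.
move=> ul; have ul0 : nrm2 (u x - l) @[x --> F] --> (0 : R).
  apply/cvgrPdist_lt => e e0; move/cvg_nrm2P : ul => /(_ e e0).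
  by apply: filterS => x; rewrite sub0r normrN ger0_norm // nrm2_ge0.
apply: (@cvg_ext _ _ _ _
    (fun x => nrm2 (u x - l) + (rip l (u x) + rip l (u x) - nrm2 l))) => [x|].
  by rewrite nrm2B (ripC l); ring.
have h : rip l (u x) @[x --> F] --> rip l l by exact: cvg_rip.
suff : nrm2 (u x - l) + (rip l (u x) + rip l (u x) - nrm2 l) @[x --> F] -->
    0 + (rip l l + rip l l - nrm2 l).
  by rewrite /nrm2 addrK add0r.
exact: (cvgD ul0 (cvgB (cvgD h h) (cvg_cst (nrm2 l)))).
Qed.

Lemma partial_sum_op (I : choiceType) (H' : hilbertType R) (F : I -> H -> H')
    (A : {fset I}) x : partial_sum F A x = \sum_(i <- A) F i x.
Proof. by rewrite partial_sumE fct_sumE. Qed.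

(** Operators are added before evaluation here, so that a partial sum of positive operators can be
    used as a positive operator. *)
Lemma sot_sumP (I : choiceType) (H' : hilbertType R) (F : I -> H -> H') S :
  sot_sum F S <-> forall x, partial_sum F A x @[A --> totally] --> S x.
Proof.
by split=> FS x; apply: cvg_ext (FS x) => A /=;
  rewrite partial_sum_op partial_sumE.
Qed.

Lemma sot_cvg (I : choiceType) (H' : hilbertType R) (F : I -> H -> H') S :
  sot_sum F S -> forall x, partial_sum F A x @[A --> totally] --> S x.
Proof. by move/sot_sumP. Qed.

Lemma qf_partial_sum (I : choiceType) (F : I -> H -> H) (A : {fset I}) x :
  qf (partial_sum F A) x = \sum_(i <- A) qf (F i) x.
Proof. by rewrite partial_sumE qf_sum. Qed.

Lemma positive_partial_sum (I : choiceType) (F : I -> H -> H) (A : {fset I}) :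
  (forall i, positive_op (F i)) -> positive_op (partial_sum F A).
Proof. by move=> pF; rewrite partial_sumE; exact: positive_op_sum. Qed.

Lemma sot_sum_qf (I : choiceType) (F : I -> H -> H) (S : H -> H) :
  (forall i, positive_op (F i)) -> sot_sum F S ->
  forall x, \esum_(i in [set: I]) (qf (F i) x)%:E = (qf S x)%:E.
Proof.
move=> pF FS x; apply: esum_cvg_fset => [i|]; first exact: qf_ge0.
apply: (@cvg_ext _ _ _ _ (fun A => rip x (partial_sum F A x))) => [A|].
  by rewrite -qf_partial_sum.
exact: cvg_rip (sot_cvg (x := x) FS).
Qed.

Lemma sot_sum_unique (I : choiceType) (F : I -> H -> H) (S S' : H -> H) :
  sot_sum F S -> sot_sum F S' -> S = S'.
Proof.
by move=> FS FS'; apply/funext => x; exact: cvg_hilbert_unique (FS x) (FS' x).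
Qed.

Section Bounded.
Variables (I : choiceType) (F : I -> H -> H) (c : R).
Hypothesis pF : forall i, positive_op (F i).
Hypothesis c0 : 0 <= c.
Hypothesis Fc : forall x,
  (\esum_(i in [set: I]) (qf (F i) x)%:E <= (c * nrm2 x)%:E)%E.

Let qf_fset_le (A : {fset I}) x : \sum_(i <- A) qf (F i) x <= c * nrm2 x.
Proof. by rewrite -lee_fin (le_trans _ (Fc x)) // le_fset_esum. Qed.

Let esum_fin x : exists t, \esum_(i in [set: I]) (qf (F i) x)%:E = t%:E.
Proof.
exists (fine (\esum_(i in [set: I]) (qf (F i) x)%:E)).
rewrite fineK // ge0_fin_numE; first by rewrite (le_lt_trans (Fc x)) ?ltry.
by apply: esum_ge0 => i _; rewrite lee_fin qf_ge0.
Qed.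

(** The difference of nested partial sums is again a partial sum, hence positive with form at most c
    |x|^2, and [positive_nrm2] applies. *)
Let partial_cauchy (A0 A : {fset I}) x : (A0 `<=` A)%fset ->
  nrm2 (partial_sum F A x - partial_sum F A0 x) <=
  c * (\sum_(i <- A) qf (F i) x - \sum_(i <- A0) qf (F i) x).
Proof.
move=> sA; rewrite !partial_sum_op !(sum_fsetD _ sA) !(addrC (\sum_(i <- A0) _)).
rewrite !addrK -partial_sum_op -qf_partial_sum.
apply: positive_nrm2 => //; first exact: positive_partial_sum.
by move=> y; rewrite qf_partial_sum.
Qed.

(** By [partial_cauchy] the vectors converge because the scalar forms do; linearity, symmetry and
    the bounds pass to the limit. *)
Lemma monotone_sot_sum : exists Y, [/\ positive_op Y, sot_sum F Y
  & forall x, \esum_(i in [set: I]) (qf (F i) x)%:E = (qf Y x)%:E].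
Proof.
have /choice[Y FY] x : exists l : H, partial_sum F A x @[A --> totally] --> l.
  apply: cvg_hilbert => e e0; have [t tE] := esum_fin x.
  have /cvgrPdist_lt /(_ (e / (c + 1))) :
      (\sum_(i <- A) qf (F i) x) @[A --> totally] --> t.
    by apply: cvg_esum_fset => // i; exact: qf_ge0.
  case; first by rewrite divr_gt0 // ltr_wpDl.
  move=> A0 _ /= /(_ _ (fsubset_refl _)) /=.
  have qA (A : {fset I}) : \sum_(i <- A) qf (F i) x <= t.
    by rewrite -lee_fin -tE le_fset_esum.
  rewrite ger0_norm ?subr_ge0 // ltr_pdivlMr ?ltr_wpDl // => h.
  exists (partial_sum F A0 x); apply: (near_totally (A0 := A0)) => A sA.
  apply: le_lt_trans (partial_cauchy _ sA) _; apply: le_lt_trans h.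
  rewrite [leRHS]mulrDr mulr1 [X in _ <= X + _]mulrC; apply: ler_wpDr.
    by rewrite subr_ge0.
  by rewrite ler_wpM2l // lerB.
have pS A := positive_partial_sum A pF.
have linY : linear Y.
  move=> a x y; apply: (cvg_hilbert_unique (FY _)).
  apply: (@cvg_ext _ _ _ _
      (fun A => a *: partial_sum F A x + partial_sum F A y)) => [A|].
    by rewrite (positive_lin (pS A)).
  exact: (cvgD (cvgZr (FY x)) (FY y)).
have nY x : nrm2 (Y x) <= c * c * nrm2 x.
  apply: (cvgr_to_le (cvg_nrm2 (FY x))).
  apply: (near_totally (A0 := fset0)) => A _.
  have Sc y : qf (partial_sum F A) y <= c * nrm2 y by rewrite qf_partial_sum.
  by rewrite (le_trans (positive_nrm2 x (pS A) c0 Sc)) // -mulrA ler_wpM2l.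
have bY : bounded_op Y.
  by apply/bounded_opP; split=> //; exists (c * c); rewrite ?mulr_ge0.
have qY x : (\sum_(i <- A) qf (F i) x) @[A --> totally] --> qf Y x.
  apply: (@cvg_ext _ _ _ _ (fun A => rip x (partial_sum F A x))) => [A|].
    by rewrite -qf_partial_sum.
  exact: cvg_rip (FY x).
exists Y; split => [||x]; last 1 first.
- by apply: esum_cvg_fset => // i; exact: qf_ge0.
- apply/positive_opP; split=> // [x y|x].
    apply: (cvg_real_unique (cvg_rip (y := x) (FY y))).
    apply: (@cvg_ext _ _ _ _ (fun A => rip y (partial_sum F A x))) => [A|].
      by rewrite (positive_sym (pS A)) ripC.
    by rewrite ripC; exact: cvg_rip (FY x).
  apply: (cvgr_to_ge (qY x)).
  by apply: (near_totally (A0 := fset0)) => A _; apply: sumr_ge0 => i _; exact: qf_ge0.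
- exact/sot_sumP.
Qed.

End Bounded.

End MonotoneConvergence.

Lemma cvg_hilbert_near (R : realType) (H : hilbertType R) (T : Type)
    (F : set_system T) {FF : Filter F} (u : T -> H) (l : H) :
  (\forall x \near F, u x = l) -> u x @[x --> F] --> l.
Proof.
move=> ul; apply/cvg_nrm2P => e e0; apply: filterS ul => x ->.
by rewrite subrr nrm2_0.
Qed.

(** * Orthogonal projections and orthonormal bases *)

Section OrthogonalProjections.
Context {R : realType} {H : hilbertType R}.
Variables (I : choiceType) (F : I -> H -> H).
Hypothesis pF : forall i, positive_op (F i).
Hypothesis Fidem : forall i x, F i (F i x) = F i x.
Hypothesis Forth : forall i j x, i != j -> F i (F j x) = 0.

Let F_partial (A : {fset I}) i x : i \in A -> F i (partial_sum F A x) = F i x.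
Proof.
move=> iA; rewrite partial_sum_op (lin_sum (positive_lin (pF i))).
rewrite (bigD1_seq i) //= Fidem big1 ?addr0 // => j.
by rewrite eq_sym; exact: Forth.
Qed.

Let partial_F (A : {fset I}) i x : i \in A -> partial_sum F A (F i x) = F i x.
Proof.
move=> iA; rewrite partial_sum_op (bigD1_seq i) //= Fidem big1 ?addr0 // => j.
exact: Forth.
Qed.

Let bessel (A : {fset I}) x : \sum_(i <- A) qf (F i) x <= nrm2 x.
Proof.
rewrite -qf_partial_sum; set P := partial_sum F A.
have pP : positive_op P by exact: positive_partial_sum.
have PP : P (P x) = P x.
  rewrite {1}/P partial_sum_op /P [RHS]partial_sum_op big_seq [RHS]big_seq.
  by apply: eq_bigr => i iA; exact: F_partial.
(* [P] is a self-adjoint projection, so this quantity is |x|^2 - <x, P x>. *)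
have := nrm2_ge0 (x - P x).
rewrite nrm2B [nrm2 (P x)]/nrm2 -(positive_sym pP) PP /qf; lra.
Qed.

(** Bessel's inequality supplies the bound 1 for monotone convergence. Composed with one [F i], the
    partial sums are constant once i has entered. The lemma serves both an orthonormal family and
    the blocks of the tensor product. *)
Lemma orthogonal_projection_sum : exists Y, [/\ positive_op Y, sot_sum F Y,
  forall x, \esum_(i in [set: I]) (qf (F i) x)%:E = (qf Y x)%:E,
  forall i x, F i (Y x) = F i x & forall i x, Y (F i x) = F i x].
Proof.
have [x|Y [pY FY qY]] := monotone_sot_sum pF (@ler01 R).
  by rewrite mul1r; apply: esum_le => A; exact: bessel.
exists Y; split=> // i x.
  apply: (cvg_hilbert_unique (cvg_bounded_op (positive_bounded (pF i))
    (sot_cvg (x := x) FY))).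
  apply: cvg_hilbert_near; apply: (near_totally (A0 := [fset i]%fset)) => A.
  by rewrite fsub1set => iA; exact: F_partial.
apply: (cvg_hilbert_unique (sot_cvg (x := F i x) FY)).
apply: cvg_hilbert_near; apply: (near_totally (A0 := [fset i]%fset)) => A.
by rewrite fsub1set => iA; exact: partial_F.
Qed.

End OrthogonalProjections.

Section OrthonormalBases.
Context {R : realType} {H : hilbertType R}.
Implicit Types x y v : H.

Lemma bounded_rank_one x y : bounded_op (rank_one x y).
Proof.
apply/bounded_opP; split=> [a u v|].
  by rewrite /rank_one innerDr innerZr scalerDl scalerA.
exists (nrm2 x * nrm2 y) => [|u]; first by rewrite mulr_ge0 ?nrm2_ge0.
have -> : nrm2 (rank_one x y u) = ip2 y u * nrm2 x.
  by apply: complexI; rewrite nrm2ZC -ip2E rmorphM.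
by rewrite mulrC -mulrA ler_wpM2l ?nrm2_ge0 // ip2_CS.
Qed.

Lemma qf_rank_one v x : qf (rank_one v v) x = ip2 v x.
Proof.
apply: complexI; rewrite ip2E /qf /rip /rank_one innerZr innerC mulrC.
by rewrite -innerC (innerC x v) mulrC -sqr_normc; case: (inner v x) => a b;
  rewrite -add_Re2_Im2.
Qed.

Lemma positive_rank_one v : positive_op (rank_one v v).
Proof.
split=> [|x]; first exact: bounded_rank_one.
by rewrite innerZr (innerC x) mulcJ_ge0.
Qed.

Definition orthonormal (I : eqType) (e : I -> H) :=
  forall i j, inner (e i) (e j) = (i == j)%:R.

Lemma orthonormal_sum (I : choiceType) (e : I -> H) : orthonormal e ->
  exists Y, [/\ positive_op Y, sot_sum (fun i => rank_one (e i) (e i)) Y,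
    forall x, \esum_(i in [set: I]) (ip2 (e i) x)%:E = (qf Y x)%:E,
    forall i x, inner (e i) (Y x) = inner (e i) x & forall i, Y (e i) = e i].
Proof.
move=> eo; have [|i x|i j x ij|Y [pY FY qY FiY YFi]] :=
    @orthogonal_projection_sum R H I (fun i => rank_one (e i) (e i)).
- by move=> i; exact: positive_rank_one.
- by rewrite /rank_one innerZr eo eqxx mulr1.
- by rewrite /rank_one innerZr eo (negbTE ij) mulr0 scale0r.
exists Y; split=> // [x|i x|i].
- by rewrite -qY; apply: eq_esum => i _; rewrite qf_rank_one.
- have /(congr1 (inner (e i))) := FiY i x.
  by rewrite /rank_one !innerZr eo eqxx !mulr1.
- have := YFi i (e i).
  by rewrite /rank_one eo eqxx scale1r.
Qed.

(** The sum is bounded and fixes each e i, so it is the identity on the dense span. *)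
Lemma parseval_op (I : choiceType) (e : I -> H) : orthonormal_basis e ->
  sot_sum (fun i => rank_one (e i) (e i)) id.
Proof.
move=> [eo ed]; have [Y [pY FY _ _ Ye]] := orthonormal_sum eo.
suff <- : Y = id by [].
apply: (bounded_op_dense (positive_bounded pY) (bounded_op_id _) ed).
move=> _ [s ->]; rewrite (lin_sum (positive_lin pY)); apply: eq_bigr => p _.
by rewrite (lin_scale (positive_lin pY)) Ye.
Qed.

Lemma parseval (I : choiceType) (e : I -> H) x : orthonormal_basis e ->
  \esum_(i in [set: I]) (ip2 (e i) x)%:E = (nrm2 x)%:E.
Proof.
move=> /parseval_op eid.
have pe (i : I) : positive_op (rank_one (e i) (e i)) := positive_rank_one _.
rewrite -[RHS](sot_sum_qf pe eid); apply: eq_esum => i _.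
by rewrite qf_rank_one.
Qed.

(** Every x - Y x is orthogonal to the family, so Y is the identity and the partial expansions of x,
    which lie in the span, approach x. *)
Lemma dense_span_orthonormal (I : choiceType) (e : I -> H) : orthonormal e ->
  (forall x, (forall i, inner (e i) x = 0) -> x = 0) -> orthonormal_basis e.
Proof.
move=> eo e0; split=> //; have [Y [pY FY _ eY _]] := orthonormal_sum eo.
have Yid x : Y x = x.
  apply/eqP; rewrite eq_sym -subr_eq0; apply/eqP/e0 => i.
  by rewrite innerDr -scaleN1r innerZr eY mulN1r subrr.
move=> O [x Ox] oO; have : nbhs (Y x) O by rewrite Yid; exact: open_nbhs_nbhs.
move=> /(sot_cvg (x := x) FY)[A _ /(_ _ (fsubset_refl A)) /= OA].
exists (partial_sum (fun i => rank_one (e i) (e i)) A x); split=> //=.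
exists [seq (inner (e i) x, i) | i <- A].
by rewrite partial_sum_op big_map.
Qed.

(** Zorn's lemma: a nonzero vector orthogonal to a maximal orthonormal set could be normalised and
    added. This validates the choice made by [hbasis]. *)
Lemma orthonormal_basis_exists :
  exists E : set H, orthonormal_basis (fun v : E => \val v).
Proof.
pose P (E : set H) := forall u v, E u -> E v -> inner u v = (u == v)%:R.
have [G GP Gtot|E [PE Emax]] := @Zorn_bigcup H P.
  move=> u v [U GU Uu] [V GV Vv].
  have [UV|VU] := Gtot U V GU GV.
    by apply: (GP V) => //; exact: UV.
  by apply: (GP U) => //; exact: VU.
exists E; apply: dense_span_orthonormal => [u v|x Ex].
  by rewrite PE //; exact: set_valP.
apply: contrapT => /eqP x0.
have n0 : 0 < nrm2 x by rewrite lt_neqAle eq_sym nrm2_eq0 x0 nrm2_ge0.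
pose y := ((Num.sqrt (nrm2 x))^-1)%:C *: x.
have yy : inner y y = 1.
  rewrite inner_nrm2 nrm2Z exprVn sqr_sqrtr ?nrm2_ge0 // mulVf //.
  by rewrite gt_eqF.
have Ey v : E v -> inner v y = 0.
  move=> Ev; have := Ex (SigSub (mem_set Ev)); rewrite /= /y innerZr => ->.
  by rewrite mulr0.
have yE : ~ E y.
  by move=> /Ey; rewrite yy => /eqP; rewrite oner_eq0.
apply: (Emax (E `|` [set y])).
  by split=> [v Ev|h]; [left|apply: yE; apply: h; right].
move=> u v [Eu|->] [Ev|->].
- exact: PE.
- by rewrite Ey //; case: eqVneq => // uy; case: yE; rewrite -uy.
- by rewrite innerC Ey // conjc0; case: eqVneq => // yv; case: yE; rewrite yv.
- by rewrite yy eqxx.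
Qed.

Lemma hbasisP : orthonormal_basis (fun v : @hbasis R H => \val v).
Proof. exact: xgetPex orthonormal_basis_exists. Qed.

Lemma esum_set_type (E : set H) (f : H -> \bar R) :
  \esum_(v in E) f v = \esum_(v in [set: E]) f (\val v).
Proof.
apply: reindex_esum; split=> [v _|u v _ _ /val_inj //|v Ev].
  exact: set_valP.
by exists (SigSub (mem_set Ev)).
Qed.

Lemma parseval_hbasis x : \esum_(v in @hbasis R H) (ip2 v x)%:E = (nrm2 x)%:E.
Proof. by rewrite esum_set_type (parseval x hbasisP). Qed.

End OrthonormalBases.

(** * Square roots of positive operators *)

Section PositiveCone.
Context {R : realType} {H : hilbertType R}.
Variable T : H -> H.
Hypothesis pT : positive_op T.
Implicit Types S : H -> H.

(** Polynomials in [T] with nonnegative coefficients. They are positive, commute and are closed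
    under composition, which yields positivity of the square root iterates and of their
    increments. *)
Inductive power_cone : (H -> H) -> Prop :=
| power_cone0 : power_cone 0
| power_coneS S (a : R) k : power_cone S -> 0 <= a ->
    power_cone (S + a%:C *: (iter k T : H -> H)).

(** T^(k+2) is the conjugate of T^k by T, so the induction carries two consecutive powers. *)
Lemma positive_iter k : positive_op (iter k T).
Proof.
suff : positive_op (iter k T) /\ positive_op (iter k.+1 T) by case.
elim: k => [|k [pk pk1]]; first by split; [exact: positive_id|exact: pT].
split=> //; have -> : iter k.+2 T = T \o iter k T \o adj T.
  by rewrite positive_adj //; apply/funext => x /=; rewrite -iterSr.
exact: positive_conj (positive_bounded pT) pk.
Qed.

Lemma power_cone_positive S : power_cone S -> positive_op S.
Proof.
elim=> [|S' a k _ pS a0]; first exact: positive_op0.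
by apply: positive_opD => //; apply: positive_opZ => //; exact: positive_iter.
Qed.

Lemma power_coneD S S' : power_cone S -> power_cone S' -> power_cone (S + S').
Proof.
move=> pS; elim=> [|S'' a k _ IH a0]; first by rewrite addr0.
by rewrite addrA; exact: power_coneS.
Qed.

Lemma power_coneZ (a : R) S : 0 <= a -> power_cone S -> power_cone (a%:C *: S).
Proof.
move=> a0; elim=> [|S' b k _ IH b0]; first by rewrite scaler0; exact: power_cone0.
by rewrite scalerDr scalerA -rmorphM; apply: power_coneS => //; exact: mulr_ge0.
Qed.

Lemma power_cone_iter k S : power_cone S -> power_cone (iter k T \o S).
Proof.
have lk := positive_lin (positive_iter k).
elim=> [|S' a j _ IH a0].
  have -> : iter k T \o 0 = 0 :> (H -> H) by apply/funext => x /=; exact: lin_0.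
  exact: power_cone0.
have -> : iter k T \o (S' + a%:C *: (iter j T : H -> H)) =
    (iter k T \o S') + a%:C *: (iter (k + j) T : H -> H).
  apply/funext => x; rewrite /= !fctE /= (lin_add lk) (lin_scale lk).
  by rewrite iterD.
exact: power_coneS.
Qed.

Lemma power_cone_comp S S' : power_cone S -> power_cone S' ->
  power_cone (S \o S').
Proof.
move=> + pS'; elim=> [|S'' a k pS'' IH a0]; first exact: power_cone0.
have -> : (S'' + a%:C *: (iter k T : H -> H)) \o S' =
  (S'' \o S') + a%:C *: (iter k T \o S') by apply/funext => x.
by apply: power_coneD => //; apply: power_coneZ => //; exact: power_cone_iter.
Qed.

Lemma power_cone_comm S S' x : power_cone S -> power_cone S' ->
  S (S' x) = S' (S x).
Proof.
move=> + pS'; have lS' := positive_lin (power_cone_positive pS').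
have TS' y : T (S' y) = S' (T y).
  elim: {lS'} pS' => [|S'' a k _ IH a0]; first exact: (lin_0 (positive_lin pT)).
  rewrite !fctE (lin_add (positive_lin pT)) (lin_scale (positive_lin pT)).
  by rewrite IH -iterSr.
have TkS' k y : iter k T (S' y) = S' (iter k T y).
  by elim: k => //= k ->; rewrite TS'.
elim=> [|S'' a k _ IH a0]; first by rewrite (lin_0 lS').
by rewrite !fctE IH TkS' (lin_add lS') (lin_scale lS').
Qed.

End PositiveCone.

Section SquareRoot.
Context {R : realType} {H : hilbertType R}.

Lemma bounded_qf (A : H -> H) : positive_op A ->
  exists2 c : R, 0 < c & forall x, qf A x <= c * nrm2 x.
Proof.
move=> [/bounded_opP[_ [c c0 Ac]] _]; exists (c + 1); first by rewrite ltr_wpDl.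
move=> x; have := rip_CS x (A x); have := Ac x; have n0 := nrm2_ge0 x.
have A0 := nrm2_ge0 (A x); rewrite -/(qf A x) => h1 h2.
have h3 : qf A x ^+ 2 <= ((c + 1) * nrm2 x) ^+ 2.
  by rewrite (le_trans h2) // (le_trans (ler_wpM2l n0 h1)) //; nra.
rewrite leNgt; apply/negP => h4; move: h3; rewrite leNgt => /negP; apply.
by rewrite ltr_pXn2r // nnegrE ?mulr_ge0 ?addr_ge0 // ltW // (le_lt_trans _ h4) //
  mulr_ge0 ?addr_ge0.
Qed.

Section Iteration.
Variable T : H -> H.
Hypothesis pT : positive_op T.
Hypothesis T1 : forall x, qf T x <= nrm2 x.

(** Iteration from 0 for the fixed point equation Y = (T + Y^2) / 2, which says (1 - Y)^2 = 1 -
    T. *)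
Fixpoint sqrt_iter n : H -> H :=
  if n is n'.+1 then (2^-1)%:C *: (T + (sqrt_iter n' \o sqrt_iter n')) else 0.

Local Notation Y := sqrt_iter.

Let half0 : 0 <= 2^-1 :> R. Proof. by rewrite invr_ge0. Qed.

Let T_cone : power_cone T T.
Proof.
have := power_coneS 1 (power_cone0 T) (@ler01 R).
by rewrite scale1r add0r.
Qed.

Let YS n : Y n.+1 = (2^-1)%:C *: (T + (Y n \o Y n)). Proof. by []. Qed.

Let Y_cone n : power_cone T (Y n).
Proof.
elim: n => [|n IH] /=; first exact: power_cone0.
by apply: power_coneZ => //; apply: power_coneD => //; exact: power_cone_comp.
Qed.

Let Y_incr n : power_cone T (Y n.+1 - Y n).
Proof.
elim: n => [|n IH].
  have -> : Y 1 - Y 0 = (2^-1)%:C *: T.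
    apply/funext => y; rewrite /= !fctE subr0; congr (_ *: _).
    exact: addr0.
  exact: power_coneZ.
(* Difference of two squares; the iterates commute, both being in the cone. *)
have -> : Y n.+2 - Y n.+1 =
    (2^-1)%:C *: ((Y n.+1 + Y n) \o (Y n.+1 - Y n)).
  rewrite (YS n.+1) [X in _ - X]YS -scalerBr; congr (_ *: _).
  rewrite opprD addrACA subrr add0r; apply/funext => x.
  have l1 := positive_lin (power_cone_positive pT (Y_cone n.+1)).
  have l2 := positive_lin (power_cone_positive pT (Y_cone n)).
  have c := power_cone_comm pT x (Y_cone n.+1) (Y_cone n).
  move: (Y n.+1) (Y n) l1 l2 c => V W l1 l2 c.
  rewrite /= !fctE /= (lin_sub l1) (lin_sub l2) c.
  by rewrite addrA subrK.
apply: power_coneZ => //; apply: power_cone_comp => //.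
exact: power_coneD.
Qed.

Let pY n : positive_op (Y n) := power_cone_positive pT (Y_cone n).

Let qY n x : qf (Y n) x <= nrm2 x /\ nrm2 (Y n x) <= nrm2 x.
Proof.
elim: n x => [|n IH] x; first by
    rewrite qf0 [X in _ /\ X <= _]nrm2_0 nrm2_ge0.
have qYn y : qf (Y n.+1) y <= nrm2 y.
  rewrite /= qfZ qfD; have -> : qf (Y n \o Y n) y = nrm2 (Y n y).
    by rewrite -[X in X \o _]positive_adj // qf_sqr //; case: (pY n).
  by have := T1 y; have [_] := IH y; lra.
split=> //; apply: le_trans (qYn x); rewrite -[leRHS]mul1r.
by apply: positive_nrm2 => // y; rewrite mul1r.
Qed.

(** Initial segments are cofinal among finite sets of indices, so the iterates, as telescoping sums
    of positive increments, converge by the result on nets. *)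
Let A n : {fset nat} := fset_set `I_n.

Let A_cvg : A n @[n --> \oo] --> totally.
Proof.
move=> P [A0 _ A0P]; exists (\max_(i <- A0) i).+1 => // n /= nA.
apply: A0P => /=; apply/fsubsetP => i iA0; rewrite in_fset_set //; apply/mem_set => /=.
by apply: leq_ltn_trans nA; rewrite leq_bigmax_seq.
Qed.

Let F n := Y n.+1 - Y n.

Let F_sum n : partial_sum F (A n) = Y n.
Proof.
rewrite partial_sumE -fsbig_finite // -fsbig_ord -(big_mkord xpredT).
by rewrite telescope_sumr // subr0.
Qed.

(** The root is 1 - Z with Z the limit of the iterates; the recursion passes to the limit as 2 <x, Z
    x> = <x, T x> + |Z x|^2. *)
Lemma sqrt_near_id : exists2 P, positive_op P &
  forall x, nrm2 (P x) = nrm2 x - qf T x.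
Proof.
have pF n : positive_op (F n) := power_cone_positive pT (Y_incr n).
have [x|Z [pZ FZ _]] := monotone_sot_sum pF (@ler01 R).
  apply: esum_le => A0; rewrite mul1r.
  have /A_cvg[N _ /(_ N (leqnn _)) /= AN] : totally [set B | (A0 `<=` B)%fset].
    by exists A0.
  apply: le_trans (sum_fset_le (fun i => qf_ge0 x (pF i)) AN) _.
  by rewrite -qf_partial_sum F_sum; case: (qY N x).
have YZ x : Y n x @[n --> \oo] --> Z x.
  apply: (@cvg_ext _ _ _ _ (fun n => partial_sum F (A n) x)) => [n|].
    by rewrite F_sum.
  exact: (cvg_comp _ _ A_cvg (sot_cvg (x := x) FZ)).
have Z1 x : qf Z x <= nrm2 x.
  apply: (cvgr_to_le (cvg_rip (y := x) (YZ x))).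
  by exists 0%N => // n _; case: (qY n x).
have ZE x : 2 * qf Z x = qf T x + nrm2 (Z x).
  have h : qf (Y n) x @[n --> \oo] --> 2^-1 * (qf T x + nrm2 (Z x)).
    rewrite -cvg_shiftS /=.
    apply: (@cvg_ext _ _ _ _ (fun n => 2^-1 * (qf T x + nrm2 (Y n x)))) => [n|].
      rewrite /= qfZ qfD; congr (_ * (_ + _)).
      by rewrite -[X in X \o _]positive_adj // qf_sqr //; case: (pY n).
    apply: cvgMr; apply: cvgD; [exact: cvg_cst|exact: cvg_nrm2].
  have := cvg_real_unique (cvg_rip (y := x) (YZ x)) h.
  by rewrite -/(qf Z x) => ->; rewrite mulrA mulfV // mul1r.
exists (id - Z).
  by apply: positive_opB pZ _; [exact: positive_id|exact: Z1].
by move=> x; rewrite fctE nrm2B -/(qf Z x) ZE; ring.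
Qed.

End Iteration.

(** Divided by a bound [c] of its form, [A] becomes 1 - T with 0 <= T <= 1; the root of 1 - T is
    then multiplied by the square root of [c]. *)
Lemma positive_sqrt_exists (A : H -> H) : positive_op A ->
  exists P, positive_op P /\ P \o P = A.
Proof.
move=> pA; have [c c0 Ac] := bounded_qf pA; have ci0 : 0 <= c^-1.
  by rewrite invr_ge0 ltW.
have cA x : c^-1 * qf A x <= nrm2 x by rewrite mulrC ler_pdivrMr // mulrC.
pose T := id - (c^-1)%:C *: A.
have pT : positive_op T.
  apply: positive_opB => [||x]; first exact: positive_id.
    exact: positive_opZ.
  by rewrite qfZ; exact: cA.
have qT x : qf T x = nrm2 x - c^-1 * qf A x by rewrite qfB qfZ.
have [x|P pP PE] := sqrt_near_id pT.
  by rewrite qT gerBl mulr_ge0 ?qf_ge0.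
exists ((Num.sqrt c)%:C *: P).
have pcP : positive_op ((Num.sqrt c)%:C *: P).
  by apply: positive_opZ => //; exact: sqrtr_ge0.
have bcP := positive_bounded pcP.
split=> //; apply: positive_ext => // [|x].
  by rewrite -{1}(positive_adj pcP); exact: positive_sqr.
rewrite -{1}(positive_adj pcP) qf_sqr // fctE nrm2Z PE qT sqr_sqrtr ?(ltW c0) //.
by rewrite opprB addrC subrK mulrA mulfV ?mul1r // gt_eqF.
Qed.

(* [(1 + S) D = D (1 - S)] with [|1 - S| <= 1], whereas [1 + S] increases norms
   by an amount controlled from below by the nondecreasing [qf S (D (1 - S)^n x)]. *)
Lemma anticommute_qf0 (S D : H -> H) : positive_op S -> bounded_op D ->
  (forall x, qf S x <= nrm2 x) -> (forall x, S (D x) = - D (S x)) ->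
  forall x, qf S (D x) = 0.
Proof.
move=> pS bD S1 SD x; have lS := positive_lin pS; have lD := bounded_op_lin bD.
pose V y := y - S y.
have S1' y : qf S y <= 1 * nrm2 y by rewrite mul1r.
have SS y : nrm2 (S y) <= qf S y.
  by rewrite -[leRHS]mul1r; exact: positive_nrm2.
have V1 n : nrm2 (iter n V x) <= nrm2 x.
  elim: n => [|n IH] //=; apply: le_trans IH; rewrite nrm2B -/(qf S _).
  by have := SS (iter n V x); have := qf_ge0 (iter n V x) pS; lra.
pose z n := D (iter n V x).
have zS n : z n.+1 = z n + S (z n).
  by rewrite /z /= /V (lin_sub lD) SD.
have qz n : qf S (z 0) <= qf S (z n).
  elim: n => // n IH; apply: (le_trans IH).
  rewrite zS -[z n in X in _ <= X]scale1r -(rmorph1 (real_complex R)) qf_comb //.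
  rewrite expr1n !mulr1 -(addrA (qf _ _)) lerDl addr_ge0 ?qf_ge0 // mulr_ge0 //.
  by rewrite rmorph1 scale1r positive_sym //; exact: nrm2_ge0.
(* Growth at least linear; it contradicts the bound d |x|^2 unless [qf S (z 0)] is 0. *)
have nz n : n%:R * (2 * qf S (z 0)) <= nrm2 (z n).
  elim: n => [|n IH]; first by rewrite mul0r nrm2_ge0.
  rewrite zS nrm2D -/(qf S (z n)) -natr1 mulrDl mul1r.
  by have := qz n; have := nrm2_ge0 (S (z n)); lra.
have [_ [d d0 Dd]] := (bounded_opP _).1 bD.
apply/eqP; rewrite eq_le qf_ge0 // andbT leNgt; apply/negP => q0.
have q0' : 0 < 2 * qf S (z 0) by rewrite mulr_gt0.
have r0 : 0 <= d * nrm2 x / (2 * qf S (z 0)).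
  by rewrite divr_ge0 ?mulr_ge0 ?nrm2_ge0 // ltW.
have := archi_boundP r0; set n := Num.bound _; rewrite ltr_pdivrMr //.
rewrite ltNge => /negP; apply; apply: le_trans (nz n) _.
by apply: le_trans (Dd _) _; exact: ler_wpM2l.
Qed.

(** From P^2 = Q^2 it follows that P + Q and D = P - Q anticommute, so the form of P + Q vanishes on
    the range of D. As a sum of two nonnegative forms it gives P D = Q D = 0, hence |D x|^2 = <x, D
    D x> = 0. *)
Lemma positive_sqrt_unique (P Q : H -> H) : positive_op P -> positive_op Q ->
  P \o P = Q \o Q -> P = Q.
Proof.
move=> pP pQ PQ; have PQE x : P (P x) = Q (Q x) by have := congr1 (@^~ x) PQ.
have lP := positive_lin pP; have lQ := positive_lin pQ.
have pPQ : positive_op (P + Q) by exact: positive_opD.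
have [c c0 Sc] := bounded_qf pPQ; have ci0 : 0 <= c^-1.
  by rewrite invr_ge0 ltW.
have pS : positive_op ((c^-1)%:C *: (P + Q)) by exact: positive_opZ.
have bD : bounded_op (P - Q).
  by apply: bounded_opB; exact: positive_bounded.
have qSD x : qf (P + Q) ((P - Q) x) = 0.
  have : qf ((c^-1)%:C *: (P + Q)) ((P - Q) x) = 0.
    apply: anticommute_qf0 => // y.
      by rewrite qfZ mulrC ler_pdivrMr // mulrC.
    have E z : ((c^-1)%:C *: (P + Q)) z = (c^-1)%:C *: ((P + Q) z) by [].
    rewrite !E (lin_scale (bounded_op_lin bD)) -scalerN.
    congr (_ *: _); rewrite !fctE !(lin_sub lP, lin_sub lQ, lin_add lP, lin_add lQ).
    by rewrite !PQE opprB opprD [RHS]addrA addrK addrC addrA subrK.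
  by rewrite qfZ => /eqP; rewrite mulf_eq0 invr_eq0 gt_eqF //= => /eqP.
have P0 x : P ((P - Q) x) = 0 /\ Q ((P - Q) x) = 0.
  have := qSD x; rewrite qfD => h.
  have := qf_ge0 ((P - Q) x) pP; have := qf_ge0 ((P - Q) x) pQ => hQ hP.
  have [cP cP0 cPE] := bounded_qf pP; have [cQ cQ0 cQE] := bounded_qf pQ.
  split; apply/eqP; rewrite -nrm2_eq0 eq_le nrm2_ge0 andbT.
    apply: le_trans (positive_nrm2 _ pP (ltW cP0) cPE) _.
    by rewrite (_ : qf P _ = 0) ?mulr0 //; lra.
  apply: le_trans (positive_nrm2 _ pQ (ltW cQ0) cQE) _.
  by rewrite (_ : qf Q _ = 0) ?mulr0 //; lra.
apply/funext => x; apply/eqP; rewrite -subr_eq0 -nrm2_eq0 /nrm2.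
have [P1 Q1] := P0 x.
rewrite ripBl -(positive_sym pP) -(positive_sym pQ).
by rewrite [P _]P1 [Q _]Q1 subrr.
Qed.

End SquareRoot.

(** * Absolute values, traces and the trace norm *)

Section AbsoluteValue.
Context {R : realType} {H : hilbertType R}.

Lemma abs_opP (X : H -> H) : bounded_op X ->
  positive_op (abs_op X) /\ abs_op X \o abs_op X = adj X \o X.
Proof.
move=> bX.
exact: (@xgetPex _ (fun=> 0) _ (positive_sqrt_exists (positive_sqr bX))).
Qed.

Lemma abs_op_positive (X : H -> H) : positive_op X -> abs_op X = X.
Proof.
move=> pX; have [pA AE] := abs_opP (positive_bounded pX).
by apply: positive_sqrt_unique => //; rewrite AE positive_adj.
Qed.

End AbsoluteValue.

Section EsumExtra.
Context {R : realType}.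
Local Open Scope ereal_scope.

Lemma esum_swap (I J : choiceType) (A : set I) (B : set J)
    (a : I -> J -> \bar R) : (forall i j, 0 <= a i j) ->
  \esum_(i in A) \esum_(j in B) a i j = \esum_(j in B) \esum_(i in A) a i j.
Proof.
move=> a0; rewrite !esum_esum //.
rewrite (reindex_esum (B `*`` (fun=> A)) _ (fun k : J * I => (k.2, k.1))) //.
split=> [[j i] [] //|[j i] [j' i'] _ _ [-> ->] //|[i j] [Ai Bj]].
by exists (j, i).
Qed.

(** One inequality holds for every nonnegative factor; applied to the inverse of [c] it gives the
    other. *)
Lemma esumZl (I : choiceType) (A : set I) (c : R) (a : I -> \bar R) :
  (0 <= c)%R -> (forall i, 0 <= a i) ->
  \esum_(i in A) (c%:E * a i) = c%:E * \esum_(i in A) a i.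
Proof.
move=> c0 a0; have le (d : R) (b : I -> \bar R) : (0 <= d)%R ->
    (forall i, 0 <= b i) ->
    \esum_(i in A) (d%:E * b i) <= d%:E * \esum_(i in A) b i.
  move=> d0 b0; apply: ge_ereal_sup => _ [X [finX XA] <-].
  rewrite -ge0_mule_fsumr //; apply: lee_wpmul2l; first by rewrite lee_fin.
  by apply: esum_ge; exists X.
have [->|cn0] := eqVneq c 0%R.
  by rewrite mul0e esum1 // => i _; rewrite mul0e.
apply/eqP; rewrite eq_le le //=.
have ci0 : (0 <= c^-1)%R by rewrite invr_ge0.
have ca0 i : 0 <= c%:E * a i by rewrite mule_ge0 // lee_fin.
have cK x : c^-1%:E * (c%:E * x) = x by rewrite muleA -EFinM mulVf // mul1e.
have := lee_wpmul2l (x := c%:E) _ (le _ _ ci0 ca0).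
under eq_esum do rewrite cK.
by rewrite muleA -EFinM mulfV // mul1e; apply; rewrite lee_fin.
Qed.

End EsumExtra.

Section Trace.
Context {R : realType} {H : hilbertType R}.
Implicit Types X Y : H -> H.

Lemma trace_qf X : trace X = \esum_(e in @hbasis R H) (qf X e)%:E.
Proof. by []. Qed.

Lemma trace_ge0 X : positive_op X -> (0 <= trace X)%E.
Proof. by move=> pX; apply: esum_ge0 => e _; rewrite lee_fin qf_ge0. Qed.

Lemma traceD X Y : positive_op X -> positive_op Y ->
  trace (X + Y) = (trace X + trace Y)%E.
Proof.
move=> pX pY; rewrite !trace_qf -esumD; last 2 first.
- by move=> e _; rewrite lee_fin qf_ge0.
- by move=> e _; rewrite lee_fin qf_ge0.
by apply: eq_esum => e _; rewrite qfD EFinD.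
Qed.

Lemma traceZ (a : R) X : 0 <= a -> positive_op X ->
  trace (a%:C *: X) = (a%:E * trace X)%E.
Proof.
move=> a0 pX; rewrite !trace_qf -esumZl //; last first.
  by move=> e; rewrite lee_fin qf_ge0.
by apply: eq_esum => e _; rewrite qfZ EFinM.
Qed.

Lemma trace0 : trace (0 : H -> H) = 0%E.
Proof. by rewrite trace_qf; apply: esum1 => e _; rewrite qf0. Qed.

(** [X] is the sum of the operators |v_n><v_n| in the sense of quadratic forms. Such families are
    carried along by conjugation with any bounded operator. *)
Definition gram (I : choiceType) (J : set I) (v : I -> H) X := forall x,
  (qf X x)%:E = \esum_(n in J) (ip2 (v n) x)%:E.

(** Tonelli and Parseval: the basis hidden in [trace] disappears, so traces on different spaces
    become comparable. *)
Lemma trace_gram (I : choiceType) (J : set I) (v : I -> H) X :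
  gram J v X -> trace X = \esum_(n in J) (nrm2 (v n))%:E.
Proof.
move=> vX; rewrite trace_qf; under eq_esum do rewrite vX.
rewrite esum_swap; last by move=> e n; rewrite lee_fin ip2_ge0.
apply: eq_esum => n _; rewrite -parseval_hbasis.
by apply: eq_esum => e _; rewrite ip2C.
Qed.

Lemma gram_exists X : positive_op X -> exists v, gram (@hbasis R H) v X.
Proof.
move=> pX; have [P [pP PX]] := positive_sqrt_exists pX.
exists P => x; have <- : nrm2 (P x) = qf X x.
  by rewrite -PX -{2}(positive_adj pP) qf_sqr //; exact: positive_bounded.
rewrite -parseval_hbasis; apply: eq_esum => e _; congr EFin.
apply: complexI; rewrite !ip2E -[in RHS](positive_adj pP) inner_adj //.
exact: positive_bounded.
Qed.

(** Cauchy-Schwarz on each Gram vector. The bound by the trace is what monotone convergence is fed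
    with. *)
Lemma qf_le_trace X x : positive_op X ->
  ((qf X x)%:E <= (nrm2 x)%:E * trace X)%E.
Proof.
move=> /gram_exists[v vX]; rewrite vX (trace_gram vX) -esumZl ?nrm2_ge0 //.
  by apply: le_esum => e _; rewrite -EFinM lee_fin mulrC ip2_CS.
by move=> e; rewrite lee_fin nrm2_ge0.
Qed.

Lemma trace_norm_positive X : positive_op X -> trace_norm X = trace X.
Proof. by move=> pX; rewrite /trace_norm abs_op_positive. Qed.

Lemma trace_class_positive X : positive_op X -> (trace X < +oo)%E ->
  trace_class X.
Proof.
move=> pX Xoo; split; first exact: positive_bounded.
by rewrite trace_norm_positive.
Qed.

(** The vectors [X x] and [abs_op X x] have the same norm, and the form of [abs_op X] is at most d
    |x|^2. *)
Lemma nrm2_le_trace_norm X (d : R) x : bounded_op X ->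
  (trace_norm X <= d%:E)%E -> nrm2 (X x) <= d ^+ 2 * nrm2 x.
Proof.
move=> bX Xd; have [pP PX] := abs_opP bX.
have d0 : 0 <= d by rewrite -lee_fin (le_trans _ Xd) // trace_ge0.
have Pd y : qf (abs_op X) y <= d * nrm2 y.
  rewrite -lee_fin (le_trans (qf_le_trace y pP)) // EFinM muleC.
  by apply: lee_wpmul2r => //; rewrite lee_fin nrm2_ge0.
have -> : nrm2 (X x) = nrm2 (abs_op X x).
  rewrite -(qf_sqr x bX) -PX -{1}(positive_adj pP) qf_sqr //.
  exact: positive_bounded.
apply: le_trans (positive_nrm2 x pP d0 Pd) _.
by rewrite expr2 -mulrA ler_wpM2l.
Qed.

(** The trace norm dominates the operator norm. The purpose is uniqueness: strong limits are unique,
    so a trace norm sum determines its value. *)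
Lemma trace_norm_sum_sot (I : choiceType) (F : I -> H -> H) S :
  (forall i, bounded_op (F i)) -> trace_norm_sum F S -> sot_sum F S.
Proof.
move=> bF [[bS _] FS]; apply/sot_sumP => x; apply/cvg_nrm2P => e e0.
have n0 := nrm2_ge0 x; have n1 : 0 < nrm2 x + 1 by rewrite ltr_wpDl.
pose d := Num.sqrt (e / (nrm2 x + 1)).
have d0 : 0 < d by rewrite sqrtr_gt0 divr_gt0.
have de : d ^+ 2 * nrm2 x < e.
  rewrite sqr_sqrtr; last by rewrite divr_ge0 // ltW.
  by rewrite mulrAC ltr_pdivrMr // ltr_pM2l // ltrDl.
(* [trace_norm] is extended real valued; convergence to 0 makes it finite eventually. *)
move/fine_cvgP : FS => [finF /cvgrPdist_lt /(_ d d0) Fd].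
near=> A; rewrite nrm2_distC; apply: le_lt_trans de.
apply: (@nrm2_le_trace_norm (S - partial_sum F A)).
  by apply: bounded_opB => //; rewrite partial_sumE; exact: bounded_op_sum.
have finA : trace_norm (S - partial_sum F A) \is a fin_num by near: A.
rewrite -(fineK finA) lee_fin.
have : `|0 - fine (trace_norm (S - partial_sum F A))| < d by near: A.
by rewrite sub0r normrN => /ltW /(le_trans (ler_norm _)).
Unshelve. all: by end_near.
Qed.

Lemma trace_norm_sum_unique (I : choiceType) (F : I -> H -> H) S S' :
  (forall i, bounded_op (F i)) -> trace_norm_sum F S -> trace_norm_sum F S' ->
  S = S'.
Proof.
by move=> bF FS FS'; apply: (sot_sum_unique (F := F)); exact: trace_norm_sum_sot.
Qed.

(** The strong limit dominates every partial sum, so each remainder is positive and equals its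
    absolute value; its trace norm is then the tail of a convergent series of traces. *)
Lemma positive_trace_norm_sum (I : choiceType) (F : I -> H -> H) :
  (forall i, positive_op (F i)) ->
  (\esum_(i in [set: I]) trace (F i) < +oo)%E ->
  exists Y, [/\ positive_op Y, trace_norm_sum F Y,
    forall x, \esum_(i in [set: I]) (qf (F i) x)%:E = (qf Y x)%:E
    & trace Y = \esum_(i in [set: I]) trace (F i)].
Proof.
move=> pF Foo; have tF0 i := trace_ge0 (pF i).
pose t i := fine (trace (F i)).
have tE i : trace (F i) = (t i)%:E.
  rewrite fineK // ge0_fin_numE //; apply: le_lt_trans Foo.
  apply: esum_ge; exists [set i]; first by split.
  by rewrite fsbig_set1.
have t0 i : 0 <= t i by rewrite -lee_fin -tE.
have [c cE] : exists c, \esum_(i in [set: I]) (t i)%:E = c%:E.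
  exists (fine (\esum_(i in [set: I]) (t i)%:E)); rewrite fineK //.
  rewrite ge0_fin_numE ?esum_ge0 // => [|i _]; last by rewrite lee_fin.
  by under eq_esum do rewrite -tE.
have cE' : \esum_(i in [set: I]) trace (F i) = c%:E.
  by rewrite -cE; apply: eq_esum => i _; rewrite tE.
have c0 : 0 <= c.
  by rewrite -lee_fin -cE esum_ge0 // => i _; rewrite lee_fin.
have [x|Y [pY FY qY]] := monotone_sot_sum pF c0.
  rewrite EFinM -cE' muleC -esumZl ?nrm2_ge0 //.
  by apply: le_esum => i _; exact: qf_le_trace.
have trY : trace Y = c%:E.
  rewrite trace_qf; under eq_esum do rewrite -qY.
  rewrite esum_swap -?cE' // => e i; by rewrite lee_fin qf_ge0.
exists Y; split; rewrite ?trY ?cE' //.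
split; first by apply: trace_class_positive; rewrite // trY ltry.
have pS A := positive_partial_sum A pF.
have trS (A : {fset I}) : trace (partial_sum F A) = (\sum_(i <- A) t i)%:E.
  rewrite trace_qf; under eq_esum do rewrite qf_partial_sum -sumEFin.
  rewrite esum_sum => [|e i _ _]; last by rewrite lee_fin qf_ge0.
  by rewrite -sumEFin; apply: eq_bigr => i _; rewrite -tE.
have pD A : positive_op (Y - partial_sum F A).
  apply: positive_opB => // x; rewrite qf_partial_sum -lee_fin -qY.
  exact: le_fset_esum.
apply: (@cvg_ext _ _ _ _ (fun A : {fset I} => (c - \sum_(i <- A) t i)%:E)) => [A|].
  rewrite trace_norm_positive //.
  have : trace Y = (trace (partial_sum F A) + trace (Y - partial_sum F A)%R)%E.
    by rewrite -traceD // addrCA subrr addr0.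
  rewrite trS trY => h; rewrite EFinB h addeAC subee // add0e.
  by [].
apply: cvg_EFin; first by near=> A.
apply/cvgrPdist_lt => e e0.
have /cvgrPdist_lt /(_ e e0) : (\sum_(i <- A) t i) @[A --> totally] --> c.
  exact: cvg_esum_fset.
move=> [A0 _ A0P]; apply: (near_totally (A0 := A0)) => A sA.
by rewrite /= sub0r normrN; exact: A0P.
Unshelve. all: by end_near.
Qed.

End Trace.

Section Gram.
Context {R : realType} {H H' : hilbertType R}.

Lemma ip2_adj (C : H -> H') x y : bounded_op C -> ip2 y (C x) = ip2 (adj C y) x.
Proof. by move=> bC; apply: complexI; rewrite !ip2E inner_adj. Qed.

Lemma gram_conj (I : choiceType) (J : set I) (v : I -> H) (X : H -> H)
    (C : H -> H') : bounded_op C -> gram J v X ->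
  gram J (C \o v) (C \o X \o adj C).
Proof.
move=> bC vX x; rewrite qf_conj // vX; apply: eq_esum => n _.
by rewrite ip2C (ip2C _ x) /= ip2_adj.
Qed.

End Gram.

(** * The block structure of the tensor product *)

Section Blocks.
Context {R : realType} {H K T : hilbertType R}.
Variable tens : {bilinear H -> K -> T}.
Hypothesis tensP : hilbert_tensor tens.
Variables (D : set nat) (ket : D -> K).
Hypothesis ketP : orthonormal_basis ket.

Let inner_tens x x' y y' :
  inner (tens x y) (tens x' y') = inner x x' * inner y y'.
Proof. by case: tensP. Qed.

Lemma nrm2_tens x y : nrm2 (tens x y) = nrm2 x * nrm2 y.
Proof.
by apply: complexI; rewrite -inner_nrm2 inner_tens !inner_nrm2 -rmorphM.
Qed.

Lemma bounded_tensr x : bounded_op (tens x).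
Proof.
apply/bounded_opP; split=> [a y z|]; first by rewrite linearDr linearZr_LR.
by exists (nrm2 x) => [|y]; rewrite ?nrm2_ge0 ?nrm2_tens.
Qed.

(** The isometry U_j; [cosite] below is its adjoint. *)
Definition site (j : D) (x : H) : T := tens x (ket j).

Lemma bounded_site j : bounded_op (site j).
Proof.
apply/bounded_opP; split=> [a y z|].
  by rewrite /site linearDl linearZl_LR.
exists (nrm2 (ket j)) => [|y]; first exact: nrm2_ge0.
by rewrite nrm2_tens mulrC.
Qed.

Definition cosite (j : D) : T -> H := adj (site j).

Lemma bounded_cosite j : bounded_op (cosite j).
Proof. exact: bounded_adj (bounded_site j). Qed.

Lemma adj_cosite j : adj (cosite j) = site j.
Proof. exact: adjK (bounded_site j). Qed.

Lemma cosite_tens j x y : cosite j (tens x y) = inner (ket j) y *: x.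
Proof.
apply: inner_ext => z; rewrite inner_adj; last exact: bounded_site.
by rewrite inner_tens innerZl mulrC -innerC.
Qed.

Lemma cositeK j x : cosite j (site j x) = x.
Proof. by rewrite cosite_tens (proj1 ketP) eqxx scale1r. Qed.

Lemma cosite_neq i j x : i != j -> cosite i (site j x) = 0.
Proof. by move=> ij; rewrite cosite_tens (proj1 ketP) (negbTE ij) scale0r. Qed.

Lemma nrm2_site j x : nrm2 (site j x) = nrm2 x.
Proof.
rewrite nrm2_tens (_ : nrm2 (ket j) = 1) ?mulr1 //.
by rewrite /nrm2 /rip (proj1 ketP) eqxx.
Qed.

(** The composite on the right is bounded with the prescribed values on elementary tensors; their
    span is dense, so it is the operator chosen by [op_tensor]. *)
Lemma op_tensorE (A : H -> H) i j : bounded_op A ->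
  op_tensor tens A (rank_one (ket i) (ket j)) = site i \o A \o cosite j.
Proof.
move=> bA; set S0 := site i \o A \o cosite j.
have bS0 : bounded_op S0.
  exact: bounded_op_comp (bounded_op_comp (bounded_site i) bA) (bounded_cosite j).
have S0E x y : S0 (tens x y) = tens (A x) (rank_one (ket i) (ket j) y).
  rewrite /S0 /= cosite_tens (lin_scale (bounded_op_lin bA)).
  by rewrite /site /rank_one linearZl_LR linearZr_LR.
have [bS SE] : [set S | bounded_op S /\ forall x y,
    S (tens x y) = tens (A x) (rank_one (ket i) (ket j) y)]
    (op_tensor tens A (rank_one (ket i) (ket j))).
  by apply: xgetPex; exists S0.
apply: (bounded_op_dense bS bS0 (proj2 tensP)) => _ [s ->].
rewrite (lin_sum (bounded_op_lin bS)) (lin_sum (bounded_op_lin bS0)).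
by apply: eq_bigr => p _; rewrite SE S0E.
Qed.

(** Pythagoras over the blocks. The sum Y of the orthogonal projections onto the blocks fixes every
    [site i y]; density of the span of the kets, then of the elementary tensors, makes Y the
    identity. *)
Lemma site_sum x :
  \esum_(i in [set: D]) (nrm2 (cosite i x))%:E = (nrm2 x)%:E.
Proof.
pose F i := adj (cosite i) \o cosite i.
have pF i : positive_op (F i) by exact: positive_sqr (bounded_cosite i).
have FE i y : F i y = site i (cosite i y) by rewrite /F adj_cosite.
have [i y|i j y ij|Y [pY FY qY _ YF]] := orthogonal_projection_sum pF.
- by rewrite !FE cositeK.
- by rewrite !FE cosite_neq // (lin_0 (bounded_op_lin (bounded_site i))).
have lY := positive_lin pY; have bY := positive_bounded pY.
have Ysite i y : Y (site i y) = site i y.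
  by have := YF i (site i y); rewrite !FE cositeK.
have Ytens h : Y \o tens h = tens h.
  apply: (bounded_op_dense _ (bounded_tensr h) (proj2 ketP)).
    exact: bounded_op_comp bY (bounded_tensr h).
  move=> _ [s ->] /=; rewrite (lin_sum (bounded_op_lin (bounded_tensr h))).
  rewrite (lin_sum lY); apply: eq_bigr => p _.
  rewrite (lin_scale (bounded_op_lin (bounded_tensr h))) (lin_scale lY).
  by congr (_ *: _); exact: Ysite.
have Yid : Y = id.
  apply: (bounded_op_dense bY (bounded_op_id _) (proj2 tensP)) => _ [s ->].
  rewrite (lin_sum lY); apply: eq_bigr => p _.
  exact: (congr1 (@^~ p.2) (Ytens p.1)).
have := qY x; rewrite Yid => <-; apply: eq_esum => i _.
by rewrite qf_sqr //; exact: bounded_cosite.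
Qed.

Definition block (j : D) (X : T -> T) : H -> H := cosite j \o X \o site j.

Lemma blockE j X : block j X = cosite j \o X \o adj (cosite j).
Proof. by rewrite adj_cosite. Qed.

Lemma positive_block j X : positive_op X -> positive_op (block j X).
Proof. by move=> pX; rewrite blockE; exact: positive_conj (bounded_cosite j) pX. Qed.

Lemma qf_block j X x : qf (block j X) x = qf X (site j x).
Proof. by rewrite blockE qf_conj ?adj_cosite //; exact: bounded_cosite. Qed.

Lemma gram_block (I : choiceType) (J : set I) (v : I -> T) j X :
  gram J v X -> gram J (cosite j \o v) (block j X).
Proof. by move=> vX; rewrite blockE; exact: gram_conj (bounded_cosite j) vX. Qed.

Lemma blockD j X Y : block j (X + Y) = block j X + block j Y.
Proof.
apply/funext => x; rewrite /block /= !fctE /=.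
exact: lin_add (bounded_op_lin (bounded_cosite j)) _ _.
Qed.

Lemma blockZ j (a : R[i]) X : block j (a *: X) = a *: block j X.
Proof.
apply/funext => x; rewrite /block /= !fctE /=.
exact: lin_scale (bounded_op_lin (bounded_cosite j)) _ _.
Qed.

Lemma block0 j : block j 0 = 0.
Proof.
apply/funext => x; exact: lin_0 (bounded_op_lin (bounded_cosite j)).
Qed.

(** Block diagonality in terms of quadratic forms. The trace is finite but not normalised, so that
    the class is stable under nonnegative combinations. *)
Definition diagonal_state (X : T -> T) := [/\ positive_op X,
  (trace X < +oo)%E & forall x,
  (qf X x)%:E = \esum_(i in [set: D]) (qf (block i X) (cosite i x))%:E].

Lemma trace_site j (A : H -> H) : positive_op A ->
  trace (site j \o A \o cosite j) = trace A.
Proof.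
move=> /gram_exists[v vA]; rewrite (trace_gram vA).
rewrite (trace_gram (gram_conj (bounded_site j) vA)).
by apply: eq_esum => e _; rewrite /= nrm2_site.
Qed.

Lemma positive_site j (A : H -> H) : positive_op A ->
  positive_op (site j \o A \o cosite j).
Proof. exact: positive_conj (bounded_site j). Qed.

(** Compressed to the i-th block, the partial sums equal [s i] as soon as i is included. *)
Lemma block_decomposition_unique X s : block_decomposition tens ket X s ->
  forall i, s i = block i X.
Proof.
move=> [sP Xs] i; have bs j := positive_bounded (sP j).1.
have Xsot : sot_sum (fun i => op_tensor tens (s i) (rank_one (ket i) (ket i))) X.
  apply: trace_norm_sum_sot Xs => j; rewrite op_tensorE //.
  by apply: positive_bounded; apply: positive_site; case: (sP j).
apply/funext => x; symmetry.
apply: (cvg_hilbert_unique (cvg_bounded_op (bounded_cosite i)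
  (sot_cvg (x := site i x) Xsot))).
apply: cvg_hilbert_near; apply: (near_totally (A0 := [fset i]%fset)) => A.
rewrite fsub1set => iA; rewrite partial_sum_op.
rewrite (lin_sum (bounded_op_lin (bounded_cosite i))).
rewrite (bigD1_seq _ iA (fset_uniq A)) /=.
rewrite op_tensorE //= !cositeK big1 ?addr0 // => j ji.
by rewrite op_tensorE //= cosite_neq // eq_sym.
Qed.

(** The blocks of [X] form a decomposition: their series converges in trace norm to an operator with
    the same quadratic form as [X]. Uniqueness identifies it with the chosen one. *)
Lemma walk_distributionE X i : diagonal_state X ->
  walk_distribution tens ket X i = trace (block i X).
Proof.
move=> [pX Xoo qX].
pose F i := op_tensor tens (block i X) (rank_one (ket i) (ket i)).
have pB j := positive_block j pX.
have FE j : F j = site j \o block j X \o cosite j.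
  by rewrite /F op_tensorE //; exact: positive_bounded.
have pF j : positive_op (F j) by rewrite FE; exact: positive_site.
have qF j x : qf (F j) x = qf (block j X) (cosite j x).
  by rewrite FE qf_conj //; exact: bounded_site.
have tF : \esum_(j in [set: D]) trace (F j) = trace X.
  rewrite [RHS]trace_qf; under [RHS]eq_esum do rewrite qX.
  rewrite esum_swap; last by move=> x j; rewrite lee_fin qf_ge0.
  apply: eq_esum => j _; rewrite trace_qf; apply: eq_esum => e _.
  by rewrite qF.
have [|Y [pY FY qY _]] := positive_trace_norm_sum pF; first by rewrite tF.
have YX : Y = X.
  apply: positive_ext => // x; apply: EFin_inj.
  by rewrite -qY qX; apply: eq_esum => j _; rewrite qF.
have FX : trace_norm_sum F X by rewrite -YX.
have dX : block_decomposition tens ket X (block^~ X).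
  split; last exact: FX.
  move=> j; split=> //; apply: trace_class_positive => //.
  rewrite -(trace_site j (pB j)) -FE; apply: le_lt_trans Xoo; rewrite -tF.
  apply: esum_ge; exists [set j]; first by split.
  by rewrite fsbig_set1.
rewrite /walk_distribution.
have := @xgetPex _ (fun=> fun=> 0) _ (ex_intro _ _ dX).
by move=> /block_decomposition_unique ->.
Qed.

End Blocks.

(** * Sums over pairs, points and finite supports *)

Section EsumPairs.
Context {R : realType}.
Local Open Scope ereal_scope.

Lemma esum_pair (I J : choiceType) (f : I * J -> \bar R) :
  (forall p, 0 <= f p) ->
  \esum_(p in [set: I * J]) f p =
  \esum_(i in [set: I]) \esum_(j in [set: J]) f (i, j).
Proof.
move=> f0; rewrite esum_esum //.
have -> : [set: I] `*`` (fun=> [set: J]) = [set: I * J] by apply/seteqP.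
by apply: eq_esum => -[].
Qed.

Lemma esum_single (I : choiceType) (f : I -> \bar R) i : 0 <= f i ->
  (forall j, j != i -> f j = 0) -> \esum_(j in [set: I]) f j = f i.
Proof.
move=> fi0 f0; rewrite -(esum_set1 fi0) [RHS]esum_mkcond.
apply: eq_esum => j _; case: ifPn => // jNi; apply: f0.
by apply: contra jNi => /eqP ->; exact: mem_set.
Qed.

Lemma esum_unit (f : unit -> \bar R) : 0 <= f tt ->
  \esum_(n in [set: unit]) f n = f tt.
Proof. by move=> f0; apply: esum_single => // -[]. Qed.

Lemma esum_finsupp (I : choiceType) (f : I -> \bar R) (A : set I) :
  finite_set A -> (forall i, 0 <= f i) -> (forall i, ~ A i -> f i = 0) ->
  \esum_(i in [set: I]) f i = \sum_(i <- fset_set A) f i.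
Proof.
move=> finA f0 fA; rewrite -fsbig_finite //= -esum_fset // [RHS]esum_mkcond.
apply: eq_esum => i _; case: ifPn => // /negP iA; apply: fA => Ai.
exact/iA/mem_set/Ai.
Qed.

End EsumPairs.

Lemma fsbig_finsupp (I : choiceType) (V : nmodType) (f : I -> V) (A : set I) :
  finite_set A -> (forall i, ~ A i -> f i = 0) ->
  \sum_(i \in [set: I]) f i = \sum_(i <- fset_set A) f i.
Proof.
move=> finA fA; rewrite -fsbig_finite //; apply/esym/fsbig_widen => // i [_].
exact: fA.
Qed.

(** * One and two steps of the walk *)

Section Walk.
Context {R : realType} {H K T : hilbertType R}.
Variable tens : {bilinear H -> K -> T}.
Hypothesis tensP : hilbert_tensor tens.
Variables (D : set nat) (ket : D -> K).
Hypothesis ketP : orthonormal_basis ket.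
Variable B : D -> D -> D -> H -> H.
Hypothesis BP : oqrw_family B.

Local Notation block := (block tens ket).
Local Notation site := (site tens ket).
Local Notation cosite := (cosite tens ket).
Local Notation M := (oqrw tens ket B).
Local Notation diagonal_state := (diagonal_state tens ket).

Let bB i j k : bounded_op (B i j k). Proof. by case: BP. Qed.

Lemma oqrw_family_norm j k x :
  \esum_(i in [set: D]) (nrm2 (B i j k x))%:E = (nrm2 x)%:E.
Proof.
have pF i : positive_op (adj (B i j k) \o B i j k) by exact: positive_sqr.
have := sot_sum_qf pF (BP.2 j k) x; rewrite -/(nrm2 x) /qf => <-.
by apply: eq_esum => i _; rewrite -qf_sqr.
Qed.

Definition transition k i j X := B i j k \o block j X \o adj (B i j k).

Lemma positive_transition k i j X : positive_op X ->
  positive_op (transition k i j X).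
Proof.
by move=> pX; apply: positive_conj; [exact: bB|exact: positive_block].
Qed.

Lemma kraus_conj k i j X :
  oqrw_kraus tens ket B i j k \o X \o adj (oqrw_kraus tens ket B i j k) =
  site i \o transition k i j X \o cosite i.
Proof.
have bs l : bounded_op (site l) by exact: bounded_site.
have bc l : bounded_op (cosite l) by exact: bounded_cosite.
have bsB : bounded_op (site i \o B i j k) by exact: bounded_op_comp.
rewrite /oqrw_kraus op_tensorE // (adj_comp bsB (bc j)) (adj_comp (bs i) (bB i j k)).
by apply/funext => x; rewrite /= adj_cosite.
Qed.

(** On a Gram family, summing over the target site uses the normalisation of [B], and summing over
    the source site is [site_sum]. The resulting finiteness makes the series of the walk converge in
    trace norm. *)
Lemma trace_transition_sum k X : positive_op X ->
  \esum_(p in [set: D * D])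
     trace (site p.1 \o transition k p.1 p.2 X \o cosite p.1) = trace X.
Proof.
move=> pX; have [v vX] := gram_exists pX.
have tE i j : trace (site i \o transition k i j X \o cosite i) =
    \esum_(e in @hbasis R T) (nrm2 (B i j k (cosite j (v e))))%:E.
  rewrite trace_site //; last exact: positive_transition.
  exact: trace_gram (gram_conj (bB _ _ _) (gram_block tensP ket j vX)).
rewrite esum_pair => [|p]; last first.
  by apply: trace_ge0; apply: positive_site => //; exact: positive_transition.
under eq_esum do under eq_esum do rewrite tE.
rewrite esum_swap; last by move=> i j; apply: esum_ge0 => e _; rewrite lee_fin nrm2_ge0.
rewrite (trace_gram vX).
under [RHS]eq_esum do rewrite -(site_sum tensP ketP).
rewrite [RHS]esum_swap; last by move=> e j; rewrite lee_fin nrm2_ge0.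
apply: eq_esum => j _; rewrite esum_swap; last first.
  by move=> i e; rewrite lee_fin nrm2_ge0.
by apply: eq_esum => e _; rewrite /= oqrw_family_norm.
Qed.

Lemma oqrwP k X : positive_op X -> (trace X < +oo)%E ->
  [/\ positive_op (M k X), (trace (M k X) < +oo)%E
    & forall x, (qf (M k X) x)%:E = \esum_(i in [set: D]) \esum_(j in [set: D])
        (qf (transition k i j X) (cosite i x))%:E].
Proof.
move=> pX Xoo.
pose G (p : D * D) := oqrw_kraus tens ket B p.1 p.2 k \o X \o
  adj (oqrw_kraus tens ket B p.1 p.2 k).
have GE p : G p = site p.1 \o transition k p.1 p.2 X \o cosite p.1.
  exact: kraus_conj.
have pG p : positive_op (G p).
  by rewrite GE; apply: positive_site => //; exact: positive_transition.
have tG : \esum_(p in [set: D * D]) trace (G p) = trace X.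
  by rewrite -(trace_transition_sum k pX); apply: eq_esum => p _; rewrite GE.
have [|Y [pY FY qY tY]] := positive_trace_norm_sum pG; first by rewrite tG.
have -> : M k X = Y.
  apply: (trace_norm_sum_unique (F := G) _ _ FY).
    by move=> p; exact: positive_bounded.
  exact: (@xgetPex _ (fun=> 0) _ (ex_intro _ _ FY)).
split=> // [|x]; first by rewrite tY tG.
rewrite -qY esum_pair => [|p]; last by rewrite lee_fin qf_ge0.
apply: eq_esum => i _; apply: eq_esum => j _.
by rewrite GE qf_conj //; exact: bounded_site.
Qed.

Lemma qf_block_oqrw k X i x : positive_op X -> (trace X < +oo)%E ->
  (qf (block i (M k X)) x)%:E =
  \esum_(j in [set: D]) (qf (transition k i j X) x)%:E.
Proof.
move=> pX Xoo; have [_ _ MX] := oqrwP k pX Xoo.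
have p0 l j y : (0 <= (qf (transition k l j X) y)%:E)%E.
  by rewrite lee_fin qf_ge0 //; exact: positive_transition.
rewrite qf_block // MX (@esum_single _ _ _ i) ?cositeK //.
  by apply: esum_ge0.
move=> l li; apply: esum1 => j _; rewrite cosite_neq //.
by rewrite /qf rip0l.
Qed.

Lemma diagonal_oqrw k X : positive_op X -> (trace X < +oo)%E ->
  diagonal_state (M k X).
Proof.
move=> pX Xoo; have [pM Moo MX] := oqrwP k pX Xoo; split=> // x.
by rewrite MX; apply: eq_esum => i _; rewrite qf_block_oqrw.
Qed.

Lemma gram_transition (I : choiceType) (J : set I) (w : D -> I -> H) k i j X :
  gram J (w j) (block j X) -> gram J (B i j k \o w j) (transition k i j X).
Proof. by move=> wX; apply: gram_conj. Qed.

Lemma trace_block_oqrw (I : choiceType) (J : set I) (w : D -> I -> H) k X i :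
  positive_op X -> (trace X < +oo)%E ->
  (forall j, gram J (w j) (block j X)) ->
  trace (block i (M k X)) =
  \esum_(j in [set: D]) \esum_(n in J) (nrm2 (B i j k (w j n)))%:E.
Proof.
move=> pX Xoo wX; rewrite trace_qf.
under eq_esum do rewrite qf_block_oqrw //.
rewrite esum_swap; last first.
  by move=> e j; rewrite lee_fin qf_ge0 //; exact: positive_transition.
apply: eq_esum => j _; rewrite -trace_qf.
exact: trace_gram (gram_transition k i (wX j)).
Qed.

(** The new Gram vectors are indexed by pairs of a source site and an old index. As the index type
    is arbitrary, one-step formulas apply again to the result. *)
Lemma gram_block_oqrw (I : choiceType) (J : set I) (w : D -> I -> H) k X i :
  positive_op X -> (trace X < +oo)%E ->
  (forall j, gram J (w j) (block j X)) ->
  gram ([set: D] `*`` (fun=> J)) (fun p => B i p.1 k (w p.1 p.2))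
    (block i (M k X)).
Proof.
move=> pX Xoo wX x; rewrite qf_block_oqrw // -(esum_esum (J := fun=> J)
  (a := fun j n => (ip2 (B i j k (w j n)) x)%:E)); last first.
  by move=> j n _ _; rewrite lee_fin ip2_ge0.
by apply: eq_esum => j _; exact: gram_transition.
Qed.

Lemma trace_block_oqrw2 (I : choiceType) (J : set I) (w : D -> I -> H) k l X i :
  positive_op X -> (trace X < +oo)%E ->
  (forall j, gram J (w j) (block j X)) ->
  trace (block i (M k (M l X))) =
  \esum_(j in [set: D]) \esum_(n in J) \esum_(m in [set: D])
    (nrm2 (B i m k (B m j l (w j n))))%:E.
Proof.
move=> pX Xoo wX; have [pM Moo _] := oqrwP l pX Xoo.
rewrite (trace_block_oqrw _ _ pM Moo (fun m => gram_block_oqrw l m pX Xoo wX)).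
rewrite esum_swap; last by move=> m p; rewrite lee_fin nrm2_ge0.
rewrite -(esum_esum (J := fun=> J) (a := fun j n => \esum_(m in [set: D])
    (nrm2 (B i m k (B m j l (w j n))))%:E)) // => j n _ _.
by apply: esum_ge0 => m _; rewrite lee_fin nrm2_ge0.
Qed.

Lemma diagonal_state0 : diagonal_state 0.
Proof.
split=> [||x]; first exact: positive_op0.
  by rewrite trace0 ltry.
rewrite qf0 esum1 // => i _; rewrite block0 ?qf0 //.
Qed.

Lemma diagonal_stateD X Y :
  diagonal_state X -> diagonal_state Y -> diagonal_state (X + Y).
Proof.
move=> [pX Xoo qX] [pY Yoo qY]; split=> [||x]; first exact: positive_opD.
  by rewrite traceD // lte_add_pinfty.
rewrite qfD EFinD qX qY -esumD => [|i _|i _].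
- by apply: eq_esum => i _; rewrite blockD // qfD.
- by rewrite lee_fin qf_ge0 //; exact: positive_block.
- by rewrite lee_fin qf_ge0 //; exact: positive_block.
Qed.

Lemma diagonal_stateZ (a : R) X : 0 <= a ->
  diagonal_state X -> diagonal_state (a%:C *: X).
Proof.
move=> a0 [pX Xoo qX]; split=> [||x]; first exact: positive_opZ.
  by rewrite traceZ // lte_mul_pinfty // lee_fin.
rewrite qfZ EFinM qX -esumZl // => [|i].
  by apply: eq_esum => i _; rewrite blockZ // qfZ.
by rewrite lee_fin qf_ge0 //; exact: positive_block.
Qed.

Section Combination.
Variables (q : D -> R) (X : D -> T -> T).
Hypothesis q0 : forall m, 0 <= q m.
Hypothesis qfin : finite_set [set m | q m != 0].
Hypothesis dX : forall m, diagonal_state (X m).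

Let combination_fset : \sum_(m \in [set: D]) (q m)%:C *: X m =
  \sum_(m <- fset_set [set m | q m != 0]) (q m)%:C *: X m.
Proof.
by apply: fsbig_finsupp => // m /negP/negPn/eqP ->; rewrite scale0r.
Qed.

Lemma diagonal_combination :
  diagonal_state (\sum_(m \in [set: D]) (q m)%:C *: X m).
Proof.
rewrite combination_fset; elim/big_ind : _.
- exact: diagonal_state0.
- exact: diagonal_stateD.
- by move=> m _; exact: diagonal_stateZ.
Qed.

(** Linearity of the distribution on finite nonnegative combinations; the value is kept as an
    unordered sum over [D], ready for interchanges. *)
Lemma walk_distribution_combination i :
  walk_distribution tens ket (\sum_(m \in [set: D]) (q m)%:C *: X m) i =
  \esum_(m in [set: D]) ((q m)%:E * trace (block i (X m)))%E.
Proof.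
rewrite (walk_distributionE tensP ketP _ diagonal_combination) combination_fset.
have pX m : positive_op (block i (X m)).
  by apply: positive_block => //; case: (dX m).
have bE (s : seq D) : block i (\sum_(m <- s) (q m)%:C *: X m) =
    \sum_(m <- s) (q m)%:C *: block i (X m).
  elim: s => [|m s IH]; first by rewrite !big_nil block0.
  by rewrite !big_cons blockD // IH blockZ.
rewrite bE trace_qf.
under eq_esum do rewrite qf_sum -sumEFin.
rewrite esum_sum => [|e m _ _]; last by rewrite lee_fin qf_ge0 //; exact: positive_opZ.
under eq_bigr do rewrite -trace_qf traceZ //.
symmetry; apply: esum_finsupp => // [m|m /negP/negPn/eqP ->].
  by rewrite mule_ge0 ?lee_fin ?trace_ge0.
by rewrite mul0e.
Qed.

End Combination.

End Walk.

(** * Products in the free vector space *)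

Section StructureConstants.
Context {R : realType} (D : set nat) (Q : D -> D -> D -> R).

(** A sum over [[set: D]] is 0 by convention when its support is infinite, hence the finite set [A]
    carrying the support of [f]. *)
Lemma Zmul_Zbasis (f : D -> R[i]) (A : set D) k m : finite_set A ->
  (forall i, ~ A i -> f i = 0) ->
  Zmul Q f (Zbasis R k) m = \sum_(i <- fset_set A) f i * (Q i k m)%:C.
Proof.
move=> finA fA; rewrite /Zmul.
have E i : \sum_(j \in [set: D]) f i * Zbasis R k j * (Q i j m)%:C =
    f i * (Q i k m)%:C.
  rewrite (fsbig_finsupp (A := [set k])) ?fset_set1 ?big_seq_fset1 //.
    by rewrite /Zbasis eqxx mulr1.
  move=> j /= jk; rewrite /Zbasis (_ : (k == j) = false) ?mulr0 ?mul0r //.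
  by apply/eqP => kj; apply: jk.
under eq_fsbigr do rewrite E.
by apply: fsbig_finsupp => // i /fA ->; rewrite mul0r.
Qed.

(** Products nest from the left, so a symbol appended at the end is a factor on the right. *)
Lemma Qcoef_rcons k ks l : Qcoef Q (rcons (k :: ks) l) =
  Zmul Q (Qcoef Q (k :: ks)) (Zbasis R l).
Proof. by apply/funext => m; rewrite /= map_rcons foldl_rcons. Qed.

End StructureConstants.

(** * Equivalence of the two conditions, and iteration *)

Section WalkStructure.
Context {R : realType} {H K T : hilbertType R}.
Variable tens : {bilinear H -> K -> T}.
Hypothesis tensP : hilbert_tensor tens.
Variables (D : set nat) (ket : D -> K).
Hypothesis ketP : orthonormal_basis ket.
Variable B : D -> D -> D -> H -> H.
Hypothesis BP : oqrw_family B.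
Variable Q : D -> D -> D -> R.
Hypothesis Q_ge0 : forall i j k, 0 <= Q i j k.
Hypothesis Q_fin : forall i j, finite_set [set k | Q i j k != 0].

Local Notation block := (block tens ket).
Local Notation site := (site tens ket).
Local Notation cosite := (cosite tens ket).
Local Notation M := (oqrw tens ket B).
Local Notation walk_distribution := (walk_distribution tens ket).

Let bB i j k : bounded_op (B i j k). Proof. by case: BP. Qed.

(* The operator identity (a), tested on vectors. *)
Definition compatible := forall i j k l x,
  \esum_(m in [set: D]) (nrm2 (B i m k (B m j l x)))%:E =
  \esum_(m in [set: D]) ((Q k l m)%:E * (nrm2 (B i j m x))%:E)%E.

Lemma sot_sum_compatible :
  (forall i j k l : D,
    sot_sum (fun m => adj (B m j l) \o adj (B i m k) \o B i m k \o B m j l)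
      (\sum_(m \in [set: D]) (Q k l m)%:C *: (adj (B i j m) \o B i j m))) <->
  compatible.
Proof.
pose F i j k l m := adj (B m j l) \o adj (B i m k) \o B i m k \o B m j l.
pose S i j k l := \sum_(m \in [set: D]) (Q k l m)%:C *: (adj (B i j m) \o B i j m).
have FE i j k l m : F i j k l m =
    adj (B i m k \o B m j l) \o (B i m k \o B m j l).
  by rewrite adj_comp.
have bBB i j k l m : bounded_op (B i m k \o B m j l) by exact: bounded_op_comp.
have pF i j k l m : positive_op (F i j k l m) by rewrite FE; exact: positive_sqr.
have qF i j k l m x : qf (F i j k l m) x = nrm2 (B i m k (B m j l x)).
  by rewrite FE qf_sqr.
have SE i j k l : S i j k l = \sum_(m <- fset_set [set m | Q k l m != 0])
    (Q k l m)%:C *: (adj (B i j m) \o B i j m).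
  by apply: fsbig_finsupp => // m /negP/negPn/eqP ->; rewrite scale0r.
have pS i j k l : positive_op (S i j k l).
  rewrite SE; apply: positive_op_sum => m _; apply: positive_opZ => //.
  exact: positive_sqr.
have qS i j k l x : (qf (S i j k l) x)%:E =
    \esum_(m in [set: D]) ((Q k l m)%:E * (nrm2 (B i j m x))%:E)%E.
  rewrite SE qf_sum -sumEFin (esum_finsupp (Q_fin k l)) => [|m|m].
  - by apply: eq_bigr => m _; rewrite qfZ qf_sqr.
  - by rewrite mule_ge0 // lee_fin ?nrm2_ge0.
  - by move=> /negP/negPn/eqP ->; rewrite mul0e.
split=> [h i j k l x|h i j k l].
  rewrite -qS -(sot_sum_qf (pF i j k l) (h i j k l)).
  by apply: eq_esum => m _; rewrite qF.
have qFS x : \esum_(m in [set: D]) (qf (F i j k l m) x)%:E = (qf (S i j k l) x)%:E.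
  by rewrite qS -h; apply: eq_esum => m _; rewrite qF.
(* The averaged side is a finite sum, hence bounded; this gives the constant for monotone
   convergence. *)
have [c c0 Sc] := bounded_qf (pS i j k l).
have [x|Y [pY FY qY]] := monotone_sot_sum (pF i j k l) (ltW c0).
  by rewrite qFS lee_fin.
rewrite -/(S i j k l) (_ : S i j k l = Y) //; apply: positive_ext => // x.
by apply: EFin_inj; rewrite -qFS qY.
Qed.

Section Steps.
Variable X : T -> T.
Hypothesis pX : positive_op X.
Hypothesis Xoo : (trace X < +oo)%E.

Let dM m : diagonal_state tens ket (M m X) := diagonal_oqrw tensP ketP BP m pX Xoo.

Lemma walk_distribution_step2 k l i : walk_distribution (M k (M l X)) i =
  trace (block i (M k (M l X))).
Proof.
have [pM Moo _] := oqrwP tensP ketP BP l pX Xoo.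
exact (walk_distributionE tensP ketP i (diagonal_oqrw tensP ketP BP k pM Moo)).
Qed.

Lemma walk_distribution_average k l i : walk_distribution
    (\sum_(m \in [set: D]) (Q k l m)%:C *: M m X) i =
  \esum_(m in [set: D]) ((Q k l m)%:E * trace (block i (M m X)))%E.
Proof.
exact (walk_distribution_combination tensP ketP (Q_ge0 k l) (Q_fin k l) dM i).
Qed.

(** The sum over m is brought innermost, at a fixed Gram vector, where [compatible] can be
    applied. *)
Lemma average_gram (I : choiceType) (J : set I) (w : D -> I -> H) k l i :
  (forall j, gram J (w j) (block j X)) ->
  \esum_(m in [set: D]) ((Q k l m)%:E * trace (block i (M m X)))%E =
  \esum_(j in [set: D]) \esum_(n in J) \esum_(m in [set: D])
    ((Q k l m)%:E * (nrm2 (B i j m (w j n)))%:E)%E.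
Proof.
move=> wX.
have p0 m j n : (0 <= (Q k l m)%:E * (nrm2 (B i j m (w j n)))%:E)%E.
  by rewrite mule_ge0 // lee_fin ?nrm2_ge0.
under [RHS]eq_esum do rewrite esum_swap //.
rewrite [RHS]esum_swap; last by move=> j m; exact: esum_ge0.
apply: eq_esum => m _; rewrite (trace_block_oqrw tensP ketP BP _ _ pX Xoo wX).
rewrite -esumZl // => [|j]; last first.
  by apply: esum_ge0 => n _; rewrite lee_fin nrm2_ge0.
apply: eq_esum => j _; rewrite -esumZl // => n.
by rewrite lee_fin nrm2_ge0.
Qed.

Lemma compatible_step k l i : compatible -> trace (block i (M k (M l X))) =
  \esum_(m in [set: D]) ((Q k l m)%:E * trace (block i (M m X)))%E.
Proof.
move=> QB; have [v vX] := gram_exists pX.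
have wX j := gram_block tensP ket j vX.
rewrite (average_gram _ _ _ wX) (trace_block_oqrw2 tensP ketP BP _ _ _ pX Xoo wX).
by apply: eq_esum => j _; apply: eq_esum => n _; exact: QB.
Qed.

End Steps.

(* The distribution is tested on the pure states [|xi (x) j><xi (x) j|]. *)
Lemma compatible_pure :
  (forall k l rho, state rho -> walk_distribution (M k (M l rho)) =
    walk_distribution (\sum_(m \in [set: D]) (Q k l m)%:C *: M m rho)) ->
  compatible.
Proof.
move=> h; have unit_case i j k l x : nrm2 x = 1 ->
    \esum_(m in [set: D]) (nrm2 (B i m k (B m j l x)))%:E =
    \esum_(m in [set: D]) ((Q k l m)%:E * (nrm2 (B i j m x))%:E)%E.
  move=> x1; pose v := site j x; pose rho := rank_one v v.
  have prho : positive_op rho by exact: positive_rank_one.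
  have grho : gram [set: unit] (fun=> v) rho.
    by move=> y; rewrite qf_rank_one esum_unit // lee_fin ip2_ge0.
  have trho : trace rho = 1%E.
    rewrite (trace_gram grho) esum_unit ?lee_fin ?nrm2_ge0 //.
    by rewrite (nrm2_site tensP ketP) x1.
  have rhooo : (trace rho < +oo)%E by rewrite trho ltry.
  have srho : state rho by split=> //; exact: trace_class_positive.
  have wX j' := gram_block tensP ket j' grho.
  have := congr1 (@^~ i) (h k l rho srho).
  rewrite /= walk_distribution_step2 // walk_distribution_average //.
  rewrite (average_gram prho rhooo _ _ _ wX).
  rewrite (trace_block_oqrw2 tensP ketP BP _ _ _ prho rhooo wX).
  (* Only the j-th block of [v] is nonzero and the summands vanish at 0, so the two outer sums
     collapse. *)
  have E (f : D -> D -> H -> \bar R) : (forall j m y, (0 <= f j m y)%E) ->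
      (forall j m, f j m 0 = 0%E) ->
      \esum_(j' in [set: D]) \esum_(n in [set: unit]) \esum_(m in [set: D])
        f j' m (cosite j' v) = \esum_(m in [set: D]) f j m x.
    move=> f0 fz; rewrite (esum_single (i := j)).
    + by rewrite esum_unit ?cositeK //; exact: esum_ge0.
    + by apply: esum_ge0 => ? _; exact: esum_ge0.
    + move=> j' j'j; apply: esum1 => _ _; apply: esum1 => m _.
      by rewrite cosite_neq.
  rewrite (E (fun j m y => (nrm2 (B i m k (B m j l y)))%:E)).
  - rewrite (E (fun j m y => ((Q k l m)%:E * (nrm2 (B i j m y))%:E)%E)) //.
    + by move=> j' m y; rewrite mule_ge0 // lee_fin ?nrm2_ge0.
    + move=> j' m; rewrite (lin_0 (bounded_op_lin (bB _ _ _))).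
      by rewrite [nrm2 _]nrm2_0 mule0.
  - by move=> j' m y; rewrite lee_fin nrm2_ge0.
  - move=> j' m; rewrite !(lin_0 (bounded_op_lin (bB _ _ _))).
    by rewrite [nrm2 _]nrm2_0.
(* Both sides are homogeneous of degree 2, so a nonzero vector can be normalised. *)
move=> i j k l x; have [->|x0] := eqVneq x 0.
  rewrite !esum1 // => m _; rewrite !(lin_0 (bounded_op_lin (bB _ _ _))).
    by rewrite [nrm2 _]nrm2_0 mule0.
  by rewrite [nrm2 _]nrm2_0.
have n0 : 0 < nrm2 x by rewrite lt_neqAle eq_sym nrm2_eq0 x0 nrm2_ge0.
pose r := Num.sqrt (nrm2 x).
have [y xE y1] : exists2 y, x = r%:C *: y & nrm2 y = 1.
  exists ((r^-1)%:C *: x).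
    by rewrite scalerA -rmorphM mulfV ?scale1r // gt_eqF // sqrtr_gt0.
  by rewrite nrm2Z exprVn sqr_sqrtr ?nrm2_ge0 // mulVf // gt_eqF.
have := congr1 (fun t => (r ^+ 2)%:E * t)%E (unit_case i j k l y y1).
rewrite -!esumZl ?sqr_ge0 //; last 2 first.
- by move=> m; rewrite mule_ge0 // lee_fin ?nrm2_ge0.
- by move=> m; rewrite lee_fin nrm2_ge0.
move=> e; rewrite xE; apply: etrans (etrans e _).
  apply: eq_esum => m _; rewrite !(lin_scale (bounded_op_lin (bB _ _ _))).
  by rewrite nrm2Z EFinM.
apply: eq_esum => m _; rewrite (lin_scale (bounded_op_lin (bB _ _ _))).
by rewrite nrm2Z [(_ * nrm2 _)%:E]EFinM muleCA.
Qed.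

(** The coefficients are chosen before [X], because the induction uses them at [M k X]. They are
    real and nonnegative, as sums of traces require, whereas [Qcoef] is complex valued. *)
Lemma oqrw_iterE ks k : compatible -> exists q : D -> R,
  [/\ forall m, 0 <= q m, finite_set [set m | q m != 0],
      forall m, Qcoef Q (rev (k :: ks)) m = (q m)%:C
    & forall X i, positive_op X -> (trace X < +oo)%E ->
      diagonal_state tens ket (oqrw_iter tens ket B (k :: ks) X) /\
      trace (block i (oqrw_iter tens ket B (k :: ks) X)) =
      \esum_(m in [set: D]) ((q m)%:E * trace (block i (M m X)))%E].
Proof.
move=> QB; elim: ks k => [|k' ks IH] k.
  (* For a single index the left-nested product is the basis vector Z_k. *)
  exists (fun m => (k == m)%:R); split=> [m|||X i pX Xoo].
  - by rewrite ler0n.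
  - apply: (sub_finite_set (B := [set k])) (finite_set1 k) => m /=.
    by case: (eqVneq k m) => [->//|_]; rewrite eqxx.
  - by move=> m /=; rewrite /Zbasis; case: eqP.
  split; first exact: diagonal_oqrw.
  rewrite (esum_single (i := k)) ?eqxx ?mul1e //.
    apply: trace_ge0; apply: positive_block => //.
    by case: (oqrwP tensP ketP BP k pX Xoo).
  by move=> m /negbTE; rewrite eq_sym => ->; rewrite mul0e.
have [q [q0 qfin qE qX]] := IH k'.
pose A := [set m | q m != 0].
(* The coordinates of sum_m q_m Z_m multiplied by Z_k on the right. *)
pose q' l := \sum_(m <- fset_set A) q m * Q m k l.
exists q'; split=> [l|||X i pX Xoo].
- by apply: sumr_ge0 => m _; exact: mulr_ge0.
- apply: (sub_finite_set (B := \bigcup_(m in A) [set l | Q m k l != 0])).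
    move=> l /= /eqP q'l; apply: contrapT => nl; apply: q'l.
    rewrite /q' big_seq big1 // => m; rewrite in_fset_set // => /set_mem Am.
    have [->|Ql] := eqVneq (Q m k l) 0; first by rewrite mulr0.
    by case: nl; exists m.
  by apply: bigcup_finite => // m _.
- move=> l; rewrite rev_cons.
  have [a [s sE]] : exists a s, rev (k' :: ks) = a :: s.
    by case: (rev (k' :: ks)) (size_rev (k' :: ks)) => // a s _; exists a, s.
  rewrite sE Qcoef_rcons -sE (Zmul_Zbasis _ _ _ qfin); last first.
    by move=> m /negP/negPn/eqP qm; rewrite qE qm.
  by rewrite /q' rmorph_sum; apply: eq_bigr => m _; rewrite qE rmorphM.
have t0 l : (0 <= trace (block i (M l X)))%E.
  apply: trace_ge0; apply: positive_block => //.
  by case: (oqrwP tensP ketP BP l pX Xoo).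
have Qt0 m l : (0 <= (Q m k l)%:E * trace (block i (M l X)))%E.
  by rewrite mule_ge0 // lee_fin.
have [pM Moo _] := oqrwP tensP ketP BP k pX Xoo.
(* The two-step law, with m as the later and k as the earlier index. *)
have stepE m : ((q m)%:E * trace (block i (M m (M k X))))%E =
    \esum_(l in [set: D]) ((q m)%:E * ((Q m k l)%:E * trace (block i (M l X))))%E.
  have /= e := compatible_step pX Xoo m k i QB.
  exact (etrans (congr1 (mule (q m)%:E) e) (esym (esumZl _ (q0 m) (Qt0 m)))).
have [dI tI] := qX _ i pM Moo; split; first exact: dI.
apply: (etrans tI); apply: (etrans (eq_esum (fun m _ => stepE m))).
have qQt0 m l : (0 <= (q m)%:E * ((Q m k l)%:E * trace (block i (M l X))))%E.
  by rewrite mule_ge0 // lee_fin.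
rewrite (esum_swap _ _ qQt0).
apply: eq_esum => l _; rewrite (esum_finsupp qfin) => [|m|m].
- rewrite /q' -sumEFin ge0_sume_distrl => [|m _].
    by apply: eq_bigr => m _; rewrite EFinM muleA.
  by rewrite lee_fin mulr_ge0.
- by rewrite mule_ge0 // lee_fin.
- by move=> /negP/negPn/eqP ->; rewrite mul0e.
Qed.

End WalkStructure.

Unset Implicit Arguments.

Theorem theorem5p1 (R : realType) (H K T : hilbertType R)
    (tens : {bilinear H -> K -> T}) (D : set nat) (ket : D -> K)
    (B : D -> D -> D -> H -> H) (Q : D -> D -> D -> R)
    (Hsep : separable_space H)
    (tensP : hilbert_tensor tens)
    (DP : distance_set D)
    (ketP : orthonormal_basis ket)
    (BP : oqrw_family B)
    (Q_ge0 : forall i j k, 0 <= Q i j k)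
    (Q_fin : forall i j, finite_set [set k | Q i j k != 0])
    (Q_sum : forall i j, \sum_(k \in [set: D]) Q i j k = 1) :
  let M := oqrw tens ket B in
  let d := walk_distribution tens ket in
  let cond_a := forall i j k l : D,
    sot_sum (fun m => adj (B m j l) \o adj (B i m k) \o B i m k \o B m j l)
      (\sum_(m \in [set: D]) (Q k l m)%:C *: (adj (B i j m) \o B i j m)) in
  let cond_b := forall (k1 k2 : D) (rho : T -> T), state rho ->
    d (M k2 (M k1 rho)) = d (\sum_(m \in [set: D]) (Q k2 k1 m)%:C *: M m rho) in
  (cond_a <-> cond_b) /\
  (cond_a -> forall (n : nat) (ks : n.-tuple D) (rho : T -> T),
    (2 <= n)%N -> state rho ->
    d (oqrw_iter tens ket B ks rho) =
    d (\sum_(m \in [set: D]) Qcoef Q (rev ks) m *: M m rho)).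
Proof.
move=> M d cond_a cond_b.
have aE : cond_a <-> compatible B Q := sot_sum_compatible BP Q_ge0 Q_fin.
have state_fin (rho : T -> T) : state rho -> (trace rho < +oo)%E.
  by case=> _ _ ->; rewrite ltry.
split; first split.
- move=> /aE QB k1 k2 rho rhoS; have [_ prho _] := rhoS.
  have rhooo := state_fin _ rhoS; apply/funext => i.
  apply: etrans (walk_distribution_step2 tensP ketP BP prho rhooo k2 k1 i) _.
  apply: etrans (compatible_step tensP ketP BP Q_ge0 prho rhooo k2 k1 i QB) _.
  exact: esym (walk_distribution_average tensP ketP BP Q_ge0 Q_fin prho rhooo k2 k1 i).
- move=> b; apply/aE; apply: (compatible_pure tensP ketP BP Q_ge0 Q_fin).
  by move=> k l rho; exact: b.
move=> /aE QB n ks rho n2 rhoS.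
have : (0 < size ks)%N by rewrite size_tuple (leq_trans _ n2).
case: (tval ks) => [|k s _]; first by rewrite ltnn.
have [_ prho _] := rhoS; have rhooo := state_fin _ rhoS.
have [q [q0 qfin qE qX]] := oqrw_iterE tensP ketP BP Q_ge0 Q_fin s k QB.
apply/funext => i; have [dI tI] := qX rho i prho rhooo.
(* The complex coefficients are exchanged for the real ones, for which the distribution of a
   combination has been computed. *)
have -> : \sum_(m \in [set: D]) Qcoef Q (rev (k :: s)) m *: M m rho =
    \sum_(m \in [set: D]) (q m)%:C *: M m rho.
  by apply: eq_fsbigr => m _; rewrite qE.
apply: etrans (walk_distributionE tensP ketP i dI) _; apply: (etrans tI).
exact: esym (walk_distribution_combination tensP ketP q0 qfin
  (fun m => diagonal_oqrw tensP ketP BP m prho rhooo) i).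
Qed.
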